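(* As $x\to\infty$, $|\mathscr{V}^1_2(x)|\sim \dfrac{\pi(x)}{2}$, where $\mathscr{V}^1_2(x)=\{m\in\mathscr{V}^1_2: m\le x\}$.
   Context: $\phi$ is Euler's totient function, $\mathrm{A}(m)=|\phi^{-1}(m)|$, and $\pi(x)$ is the number of primes $\le x$. $\mathscr{V}^1_2=\{2r: r \text{ odd positive integer},\ \mathrm{A}(2r)=2\}$. *)

(* Defs.v *)
From mathcomp Require Import all_boot all_order all_algebra finmap.
From mathcomp Require Import all_classical all_reals all_analysis.
Import Order.TTheory GRing.Theory Num.Theory.
Import numFieldNormedType.Exports.

Set Implicit Arguments.
Unset Strict Implicit.
Unset Printing Implicit Defensive.

Local Open Scope classical_set_scope.
Local Open Scope ring_scope.

(* The condition 0 < n excludes the extra mathcomp value totient 0 = 0. *)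
Definition totient_fiber (m : nat) : set nat :=
  [set n | (0 < n)%N /\ totient n = m].

(* fset_set sends an infinite set to fset0; the two finite_* lemmas below show
   that this case does not occur for the cardinals used here. *)
Definition totient_mult (m : nat) : nat := #|` fset_set (totient_fiber m)|.

Definition twice_odd_mult2 : set nat :=
  [set m | exists2 r : nat, odd r & m = (2 * r)%N /\ totient_mult m = 2%N].

Definition upto (R : realType) (S : set nat) (x : R) : set nat :=
  [set m | S m /\ m%:R <= x].

Definition counting_fun (R : realType) (S : set nat) (x : R) : nat :=
  #|` fset_set (upto S x)|.

Definition prime_pi (R : realType) (x : R) : nat :=
  counting_fun [set p | prime p] x.

Lemma finite_totient_fiber (m : nat) : finite_set (totient_fiber m).
Proof.
apply: (@sub_finite_set _ _ `I_((m * (m.+1)`!).+1)); last exact: finite_II.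
move=> n [n0 nm] /=; rewrite ltnS.
have pm p : p \in primes n -> (p < m.+2)%N.
  move=> pn; have := pn; rewrite mem_primes => /and3P[pp _ _].
  have : (p.-1 %| m)%N.
    by rewrite -nm totientE // (big_rem p) //= -mulnA dvdn_mulr.
  move/dvdn_leq; rewrite -nm totient_gt0 => /(_ n0).
  by rewrite -ltnS prednK ?prime_gt0 // => /leqW.
have nE : n = (\prod_(p <- primes n) (p ^ logn p n))%N.
  by rewrite {1}[n]prod_prime_decomp // prime_decompE big_map.
apply: (@leq_trans (m * \prod_(p <- primes n) p)).
  rewrite [leqLHS]nE -[X in (X * _)%N]nm totientE // -big_split /= big_seq [leqRHS]big_seq.
  apply: leq_prod => p pn; have := pn; rewrite -logn_gt0 => l0.
  rewrite -{1}(prednK l0) expnSr leq_mul2r; apply/orP; right.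
  have pp : prime p by move: pn; rewrite mem_primes => /and3P[].
  by rewrite leq_pmull // -ltnS prednK ?prime_gt0 ?prime_gt1.
rewrite leq_mul2l; apply/orP; right.
rewrite fact_prod.
have -> : (\prod_(p <- primes n) p =
    \prod_(1 <= p < m.+2 | p \in primes n) p)%N.
  rewrite -[RHS]big_filter; apply: perm_big; apply: uniq_perm.
  - exact: primes_uniq.
  - by rewrite filter_uniq ?iota_uniq.
  move=> p; rewrite mem_filter mem_index_iota.
  case pn: (p \in primes n) => //=; rewrite pm // andbT.
  by move: pn; rewrite mem_primes => /and3P[/prime_gt0 ->].
rewrite big_mkcond /= big_nat [leqRHS]big_nat.
by apply: leq_prod => i /andP[i0 _]; case: ifP.
Qed.

Lemma finite_upto (R : realType) (S : set nat) (x : R) : finite_set (upto S x).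
Proof.
apply: (@sub_finite_set _ _ `I_(Num.truncn x).+1); last exact: finite_II.
move=> m [_ mx] /=; rewrite -(ltr_nat R); exact: le_lt_trans mx (truncnS_gt x).
Qed.

(* Lets the Landau notations be used at +oo, like eventually_filterType for
   sequences. *)
Canonical pinfty_filter_on (R : numFieldType) :=
  FilterType (pinfty_nbhs R) _.

(* Main.v *)
(* Write chi for the nonprincipal character mod 4, mu for the Moebius function
   and M(x) for the sum of mu(n) chi(n) over n <= x.  A totient 2r with r odd is
   attained only at 4, p^k and 2 p^k with p = 3 mod 4, and the values with
   k >= 2 are too few to matter, so the theorem says that half of the primes
   are 3 mod 4, i.e. that the sum of chi(p) over p <= x is o(pi(x)).  By the
   hyperbola method and partial summation this follows from M(x) = o(x).

   Let rho(x) = |M(x)| / x.  By the Turan-Kubilius inequality over a finite set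
   of primes p, rho(x / p) is close to rho(x) for most p.  Chebyshev-type bounds
   give two such primes whose ratio q / p is close to, but bounded away from, 1,
   so that rho(x q / p) is close to rho(x); iterating, rho is nearly constant on
   [x, A x].  If rho(x) were large, M would keep its sign on [x, A x], and the
   sum of M(n) / (n (n + 1)) would grow like ln A; but partial summation bounds
   it, since the partial sums of mu(n) chi(n) / n are bounded. *)

Require Import Defs.
From mathcomp Require Import all_boot all_order all_algebra finmap.
From mathcomp Require Import zify ring lra.
From mathcomp Require Import all_classical all_reals all_analysis.
Import Order.TTheory GRing.Theory Num.Theory.
Import numFieldNormedType.Exports.

Set Implicit Arguments.
Unset Strict Implicit.
Unset Printing Implicit Defensive.

Local Open Scope classical_set_scope.
Local Open Scope ring_scope.

(** * The character mod 4 and the Moebius function *)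

(** For most primes p the two evaluations of the sum of mu chi over the multiples of p give M(x) ~
    -chi(p) p M(x / p). The sign chi(p) is what the theorem is about and is unknown at this stage,
    so only |M| is followed.

    Most p means all p outside a set of small mass for the weight 1 / p, and that set changes with
    x. So a suitable pair p, q must exist in every set of primes with more than half of the mass. An
    upper bound for primes in short intervals provides it: a set without such a pair is confined to
    a few short clusters. The lower bound on q / p keeps the number of iterations independent of x
    and of the precision of each step, so that the accumulated error can be made small afterwards.

    The bound on the partial sums of mu(n) chi(n) / n is where the nonvanishing of L(1, chi) enters;
    here it is visible, since the partial sums of 1 - 1/3 + 1/5 - ... are at least 1/2. *)

Lemma sum_multiples (V : nmodType) (q Y : nat) (G : nat -> V) : (0 < q)%N ->
  \sum_(1 <= b < Y.+1 | (q %| b)%N) G b =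
  \sum_(1 <= c < (Y %/ q).+1) G (q * c)%N.
Proof.
move=> q0; elim: Y => [|Y IH]; first by rewrite div0n !big_geq.
rewrite big_mkcond big_nat_recr //= -big_mkcond IH divnS //.
have [qY|] := boolP (q %| Y.+1)%N; last by rewrite addr0.
rewrite add1n [RHS]big_nat_recr //=; congr (_ + G _).
by rewrite -{1}(divnK qY) divnS // qY add1n mulnC.
Qed.

Lemma sum_divisors (V : nmodType) (N : nat) (F : nat -> nat -> V) :
  \sum_(1 <= a < N.+1) \sum_(1 <= b < (N %/ a).+1) F a b =
  \sum_(1 <= n < N.+1) \sum_(1 <= d < N.+1 | (d %| n)%N) F d (n %/ d)%N.
Proof.
rewrite [RHS](exchange_big_dep_nat predT) //=.
rewrite big_nat [RHS]big_nat; apply: eq_bigr => a /andP[a0 _].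
rewrite (sum_multiples N (fun n => F a (n %/ a)%N)) //.
by apply: eq_bigr => c _; rewrite mulKn.
Qed.

(** All valuations being 1 expresses squarefreeness. At 0, where [primes 0] is empty, the value is
    1; the sums below start at 1. *)
Definition moebius (R : pzRingType) (n : nat) : R :=
  if all (fun p => logn p n == 1%N) (primes n) then (-1) ^+ size (primes n) else 0.

Lemma moebius_mulp (R : pzRingType) (p n : nat) : prime p -> (0 < n)%N ->
  moebius R (p * n) = if (p %| n)%N then 0 else - moebius R n.
Proof.
move=> pp n0; rewrite /moebius.
have p0 := prime_gt0 pp.
have lpn : logn p (p * n) = (logn p n).+1 by rewrite lognM // logn_prime // eqxx.
have [pn|pn] := boolP (p %| n)%N.
  rewrite ifF //; apply/negbTE/allPn; exists p.
    by rewrite mem_primes pp muln_gt0 p0 n0 dvdn_mulr.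
  by rewrite lpn eqSS -lt0n logn_gt0 mem_primes pp n0.
have pr : perm_eq (primes (p * n)) (p :: primes n).
  apply: uniq_perm; first exact: primes_uniq.
    by rewrite /= primes_uniq mem_primes (negbTE pn) !andbF.
  by move=> q; rewrite primesM // primes_prime // !inE.
rewrite (perm_all _ pr) (perm_size pr) /= exprS mulN1r lpn.
have -> : logn p n = 0%N by rewrite lognE pp n0 (negbTE pn).
rewrite eqxx /=.
have -> : all (fun q => logn q (p * n) == 1%N) (primes n) =
   all (fun q => logn q n == 1%N) (primes n).
  apply: eq_in_all => q; rewrite mem_primes => /and3P[qp _ qn].
  rewrite lognM // (logn_prime q pp); case: (eqVneq q p) => // qEp.
  by rewrite -qEp qn in pn.
by case: ifP; rewrite // oppr0.
Qed.

(** With p the least prime factor of n, a divisor c prime to p cancels against p c, and the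
    multiples of p^2 contribute 0. The range goes up to [N] so that it does not vary with n, as in
    [sum_divisors]. *)
Lemma sum_moebius (R : pzRingType) (N n : nat) : (0 < n <= N)%N ->
  \sum_(1 <= d < N.+1 | (d %| n)%N) moebius R d = (n == 1%N)%:R.
Proof.
case/andP=> n0 nN; have [->|n1] := eqVneq n 1%N.
  rewrite (eq_bigl (fun d => d == 1%N)); last by move=> d; rewrite dvdn1.
  rewrite big_nat1_eq ifT ?ltnS ?(leq_trans n0 nN) //.
have pp : prime (pdiv n) by rewrite pdiv_prime // ltn_neqAle eq_sym n1.
have pn := pdiv_dvd n; set p := pdiv n in pp pn.
have p0 := prime_gt0 pp.
rewrite (bigID (fun d => p %| d)%N) /=.
under eq_bigl do rewrite andbC.
rewrite big_mkcondr /= (sum_multiples N (fun i => if (i %| n)%N then moebius R i else 0)) //.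
rewrite [X in _ + X](_ : _ = \sum_(1 <= c < (N %/ p).+1)
    (if (p * c %| n)%N then if (p %| c)%N then 0 else moebius R c else 0)).
  rewrite -big_split big1_seq // => c /andP[_]; rewrite mem_index_iota => /andP[c0 _].
  by rewrite moebius_mulp //=; case: (p * c %| n)%N; case: (p %| c)%N; rewrite ?addr0 ?addNr.
have NpN : ((N %/ p).+1 <= N.+1)%N by rewrite ltnS leq_div.
rewrite [RHS](big_nat_widen _ _ _ _ _ NpN) big_mkcond [RHS]big_mkcond.
rewrite big_nat [RHS]big_nat; apply: eq_bigr => d /andP[d0 dN] /=.
have [pd|pd] := boolP (p %| d)%N.
  by rewrite andbF; case: ifP => //; rewrite if_same.
have cpd : coprime p d by rewrite prime_coprime.
have -> : (p * d %| n)%N = (d %| n)%N by rewrite Gauss_dvd // pn.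
rewrite andbT; case: ifP => dn; last by rewrite if_same.
rewrite ifT // ltnS leq_divRL // (leq_trans _ nN) // dvdn_leq // mulnC.
by rewrite Gauss_dvd // pn.
Qed.

Definition chi4 (R : pzRingType) (n : nat) : R := if odd n then (-1) ^+ n./2 else 0.

Lemma chi4M (R : pzRingType) (m n : nat) : chi4 R (m * n) = chi4 R m * chi4 R n.
Proof.
rewrite /chi4 oddM; case: (boolP (odd m)) => om; last by rewrite mul0r.
case: (boolP (odd n)) => on /=; last by rewrite mulr0.
rewrite -exprD -signr_odd -[RHS]signr_odd; congr (_ ^+ nat_of_bool _).
rewrite -{1}[m]odd_double_half -{1}[n]odd_double_half om on !add1n.
have -> : (m./2.*2.+1 * n./2.*2.+1 = (m./2 * n./2 + m./2 * n./2 + m./2 + n./2).*2.+1)%N.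
  by rewrite -!muln2; ring.
by rewrite /= !uphalf_double !oddD addbb addFb.
Qed.

Lemma chi4_1 (R : pzRingType) : chi4 R 1 = 1.
Proof. by []. Qed.

Lemma sum_chi4 (R : pzRingType) (N : nat) :
  \sum_(1 <= n < N.+1) chi4 R n = (odd (uphalf N))%:R.
Proof.
elim: N => [|N IH]; first by rewrite big_geq.
rewrite big_nat_recr //= IH /chi4 /= uphalf_half; case: (odd N) => /=.
  by rewrite addr0.
rewrite add0n -signr_odd; case: (odd _) => /=; last by rewrite add0r.
by rewrite subrr.
Qed.

Lemma normr_chi4 (R : numDomainType) (n : nat) : `|chi4 R n| = (odd n)%:R.
Proof. by rewrite /chi4; case: odd; rewrite ?normr0 // normr_sign. Qed.

Lemma normr_moebius_le1 (R : numDomainType) (n : nat) : `|moebius R n| <= 1.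
Proof. by rewrite /moebius; case: ifP; rewrite ?normr0 // normr_sign. Qed.

(** For a completely multiplicative h, mu h is the Dirichlet inverse of h, so only the term at 1
    survives. It serves for h = chi and for h(n) = chi(n) / n. *)
Lemma sum_moebius_conv (R : comPzRingType) (h : nat -> R) (N : nat) :
  {morph h : a b / (a * b)%N >-> a * b} -> (0 < N)%N ->
  \sum_(1 <= a < N.+1) moebius R a * h a * \sum_(1 <= b < (N %/ a).+1) h b = h 1%N.
Proof.
move=> hM N0; under eq_bigr do rewrite mulr_sumr.
rewrite (sum_divisors N (fun a b => moebius R a * h a * h b)).
rewrite (@eq_big_nat _ _ _ _ _ _ (fun n => if n == 1%N then h 1%N else 0)); last first.
  move=> n n1N; rewrite (eq_bigr (fun d => h n * moebius R d)); last first.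
    by move=> d dn; rewrite -mulrA -hM mulnC divnK // mulrC.
  rewrite -mulr_sumr sum_moebius //.
  by case: eqVneq => [->|_]; rewrite ?mulr1 ?mulr0.
by rewrite -big_mkcond big_nat1_eq ifT.
Qed.

Lemma sum_chi4_itv (R : numDomainType) (N : nat) :
  0 <= \sum_(1 <= n < N.+1) chi4 R n <= 1.
Proof. by rewrite sum_chi4 ler0n lern1 leq_b1. Qed.

Lemma chi4_decr_sum (R : realDomainType) (g : nat -> R) (m N : nat) :
  (forall n, (m < n)%N -> 0 <= g n.+1 <= g n) -> (m <= N)%N ->
  `|\sum_(m.+1 <= n < N.+1) chi4 R n * g n| <= g m.+1.
Proof.
move=> gd /subnKC <-; move: (N - m)%N => k {N}.
pose C n := \sum_(1 <= i < n.+1) chi4 R i.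
have CS n : chi4 R n.+1 = C n.+1 - C n by rewrite /C [in X in X - _]big_nat_recr //= addrAC subrr add0r.
(* Partial summation: [Y] is the sum without its boundary term. As 0 <= C <= 1, each step moves [Y]
   by an amount between 0 and a decrement of g, so the bounds telescope. *)
pose Y k := \sum_(m.+1 <= n < (m + k).+1) chi4 R n * g n - C (m + k)%N * g (m + k).+1.
have Yb j : - (C m * g m.+1) <= Y j <= (1 - C m) * g m.+1 - g (m + j).+1.
  elim: j => [|j IH]; first by rewrite /Y addn0 big_geq // sub0r lexx /= mulrBl mul1r addrAC subrr sub0r.
  have -> : Y j.+1 = Y j + C (m + j).+1 * (g (m + j).+1 - g (m + j).+2).
    rewrite /Y addnS big_nat_recr /=; last by rewrite ltnS leq_addr.
    by rewrite CS; ring.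
  rewrite addnS; have := sum_chi4_itv R (m + j).+1; rewrite -/(C _) => /andP[C0 C1].
  have /andP[_ gd1] := gd (m + j).+1 (leq_addr j m : m < (m + j).+1)%N.
  by move/andP: IH => [IH1 IH2]; apply/andP; split; nra.
have := sum_chi4_itv R (m + k); rewrite -/(C _) => /andP[C0 C1].
have := sum_chi4_itv R m; rewrite -/(C _) => /andP[D0 D1].
have /andP[g0 _] := gd (m + k).+1 (leq_addr k m : m < (m + k).+1)%N.
have gmk : 0 <= g (m + k).+1.
  have /andP[? ?] := gd (m + k).+1 (leq_addr k m : m < (m + k).+1)%N; lra.
have gm : 0 <= g m.+1 by have /andP[? ?] := gd m.+1 (ltnSn m); lra.
have /andP[] := Yb k; rewrite /Y; set S := \sum_(_ <= _ < _) _ => Y1 Y2.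
by rewrite ler_norml; apply/andP; split; nra.
Qed.

Lemma chi4_incr_sum (R : realDomainType) (g : nat -> R) (N : nat) :
  (forall n, (0 < n)%N -> 0 <= g n <= g n.+1) -> (0 < N)%N ->
  `|\sum_(1 <= n < N.+1) chi4 R n * g n| <= g N.
Proof.
move=> gi; case: N => // N _.
pose C n := \sum_(1 <= i < n.+1) chi4 R i.
have CS n : chi4 R n.+1 = C n.+1 - C n by rewrite /C [in X in X - _]big_nat_recr //= addrAC subrr add0r.
pose Y k := \sum_(1 <= n < k.+2) chi4 R n * g n - C k.+1 * g k.+1.
have Yb j : - g j.+1 <= Y j <= 0.
  have /andP[gp1 _] := gi 1%N isT.
  elim: j => [|j IH].
    by rewrite /Y /C !big_nat1 subrr lexx oppr_le0 gp1.
  have -> : Y j.+1 = Y j + C j.+1 * (g j.+1 - g j.+2).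
    by rewrite /Y big_nat_recr //= CS; ring.
  have := sum_chi4_itv R j.+1; rewrite -/(C _) => /andP[C0 C1].
  have /andP[_ gd1] := gi j.+1 isT.
  by move/andP: IH => [IH1 IH2]; apply/andP; split; nra.
have := sum_chi4_itv R N.+1; rewrite -/(C _) => /andP[C0 C1].
have /andP[g0 _] := gi N.+1 isT.
have /andP[] := Yb N; rewrite /Y; set S := \sum_(_ <= _ < _) _ => Y1 Y2.
by rewrite ler_norml; apply/andP; split; nra.
Qed.

Definition tmoebius (R : pzRingType) (n : nat) : R := moebius R n * chi4 R n.

Lemma normr_tmoebius_le1 (R : numDomainType) (n : nat) : `|tmoebius R n| <= 1.
Proof.
rewrite normrM -[leRHS]mulr1 ler_pM //; first exact: normr_moebius_le1.
by rewrite normr_chi4 lern1 leq_b1.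
Qed.

(** Write S for the partial sums of chi(b) / b and U for the sum to bound. By Moebius inversion the
    mu(a) chi(a) / a * S(N / a) sum to 1, and replacing every S(N / a) by S(N) costs at most a / N
    each, so at most 1 in total after the weights 1 / a. Hence |U S(N) - 1| <= 1, while S(N) >= 1/2
    because S(2) = 1 and the tail is at most 1/3. *)
Lemma sum_tmoebius_inv_bound (R : realFieldType) (N : nat) :
  `|\sum_(1 <= n < N.+1) tmoebius R n / n%:R| <= 4.
Proof.
have [->|N0] := posnP N; first by rewrite big_geq // normr0.
pose h n : R := chi4 R n / n%:R.
have hM : {morph h : a b / (a * b)%N >-> a * b}.
  by move=> a b; rewrite /h chi4M natrM invfM; ring.
have := sum_moebius_conv hM N0; rewrite {3}/h chi4_1 divr1.
pose S k := \sum_(1 <= b < k.+1) h b; rewrite -/(S _) => SE.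
have invd m n : (m < n)%N -> 0 <= (n.+1%:R^-1 : R) <= n%:R^-1.
  move=> mn; have n0 := leq_ltn_trans (leq0n m) mn.
  by rewrite invr_ge0 ler0n lef_pV2 ?posrE ?ltr0n // ler_nat leqnSn.
have St k : (k <= N)%N -> `|S N - S k| <= k.+1%:R^-1.
  move=> kN; rewrite {1}/S (big_cat_nat (n := k.+1)) //= -/(S k) addrAC subrr add0r.
  exact: (chi4_decr_sum (invd k)).
have SN : 1 / 2 <= S N.
  have S1 : S 1%N = 1 by rewrite /S big_nat1 /h chi4_1 divr1.
  have S2 : S 2%N = 1.
    by rewrite /S big_nat_recr //= -/(S 1%N) S1 /h /chi4 /= mul0r addr0.
  have [N2|N2] := leqP 2 N; last by have -> : N = 1%N; [lia | rewrite S1; lra].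
  by move: (St 2%N N2); rewrite S2 ler_norml => /andP[]; lra.
pose U := \sum_(1 <= n < N.+1) tmoebius R n / n%:R.
have : `|U * S N - 1| <= 1.
  rewrite -[X in U * S N - X]SE mulr_suml -sumrB.
  apply: (le_trans (ler_norm_sum _ _ _)).
  apply: (@le_trans _ _ (\sum_(1 <= n < N.+1) N%:R^-1)); last first.
    by rewrite sumr_const_nat subn1 /= -(mulr_natr N%:R^-1 N) mulVf // pnatr_eq0 -lt0n.
  rewrite big_nat [leRHS]big_nat; apply: ler_sum => a /andP[a0 aN].
  rewrite -/(S _) /h mulrA -/(tmoebius R a) -mulrBr normrM.
  apply: (@le_trans _ _ (a%:R^-1 * (N %/ a).+1%:R^-1)).
    apply: ler_pM => //; last by apply: St; exact: leq_div.
    rewrite normrM [X in _ * X]ger0_norm ?invr_ge0 // ler_piMl ?invr_ge0 //.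
    exact: normr_tmoebius_le1.
  rewrite -invfM -natrM lef_pV2 ?posrE ?ltr0n ?muln_gt0 ?a0 //.
  by rewrite ler_nat mulnC ltnW // ltn_ceil.
rewrite -/U; move: U => U; rewrite !ler_norml => /andP[U1 U2].
by apply/andP; split; nra.
Qed.

(** * Chebyshev and Mertens estimates *)

Lemma ln_le_2sqrt (R : realType) (x : R) : 0 < x -> ln x <= 2 * Num.sqrt x.
Proof.
move=> x0; have s0 : 0 < Num.sqrt x by rewrite sqrtr_gt0.
rewrite -{1}(sqr_sqrtr (ltW x0)) lnXn // -[leLHS]mulr_natl ler_pM2l ?ltr0n //.
exact/ltW/ln_sublinear.
Qed.

Lemma lnn_ge0 (R : realType) (n : nat) : 0 <= ln n%:R :> R.
Proof.
case: n => [|n]; first by rewrite ln0.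
by rewrite ln_ge0 // ler1n.
Qed.

Lemma ler_lnn (R : realType) (m n : nat) : (0 < m)%N -> (m <= n)%N ->
  ln m%:R <= ln n%:R :> R.
Proof.
move=> m0 mn; rewrite ler_ln ?posrE ?ltr0n ?ler_nat //.
exact: leq_trans mn.
Qed.

Lemma ln_factS (R : realType) (n : nat) :
  ln n.+1`!%:R = ln n.+1%:R + ln n`!%:R :> R.
Proof. by rewrite factS natrM lnM ?posrE ?ltr0n ?fact_gt0. Qed.

Lemma ln_fact_ge (R : realType) (n : nat) :
  n%:R * ln n%:R - n%:R <= ln n`!%:R :> R.
Proof.
elim: n => [|n IH]; first by rewrite mul0r subr0 ln1.
rewrite ln_factS; case: n IH => [|n] IH.
  by rewrite !ln1 mulr0 !add0r oppr_le0 ler0n.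
have n0 : 0 < n.+1%:R :> R by rewrite ltr0n.
have : ln (1 + n.+1%:R^-1) <= n.+1%:R^-1 :> R.
  by rewrite le_ln1Dx // (lt_le_trans (ltrN10 R)) // invr_ge0 ler0n.
have -> : 1 + n.+1%:R^-1 = n.+2%:R / n.+1%:R :> R.
  by rewrite -[n.+2%:R]natr1 mulrDl mulfV ?lt0r_neq0 // mul1r.
rewrite ln_div ?posrE ?ltr0n // => H.
have : n.+1%:R * (ln n.+2%:R - ln n.+1%:R) <= 1 :> R.
  by apply: (le_trans (ler_wpM2l (ltW n0) H)); rewrite mulfV // lt0r_neq0.
move: IH; rewrite -[n.+2%:R]natr1; lra.
Qed.

Lemma ln_fact_le (R : realType) (n : nat) : ln n`!%:R <= n%:R * ln n%:R :> R.
Proof.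
elim: n => [|n IH]; first by rewrite mul0r ln1.
have nE (x : R) : n.+1%:R * x = n%:R * x + x by rewrite -natr1 mulrDl mul1r.
rewrite ln_factS nE addrC lerD2r.
apply: (le_trans IH); rewrite ler_wpM2l //.
by case: n {IH nE} => [|n]; [rewrite ln0 ?lnn_ge0 | exact: ler_lnn].
Qed.

Lemma ln_logn (R : realType) (m N : nat) : (0 < m)%N ->
  (forall p, prime p -> (p %| m)%N -> (p <= N)%N) ->
  ln m%:R = \sum_(1 <= p < N.+1 | prime p) (logn p m)%:R * ln p%:R :> R.
Proof.
move=> m0 mN.
have F0 K p : (prime p -> (p %| m)%N -> (p <= K)%N) -> (K < p)%N ->
    (logn p m)%:R * ln p%:R = 0 :> R.
  move=> pK Kp; rewrite lognE; case: ifP; rewrite ?mul0r // => /and3P[pp _ pm].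
  by move: (pK pp pm); rewrite leqNgt Kp.
pose G K : R := \sum_(1 <= p < K.+1) (logn p m)%:R * ln p%:R.
have GE K K' : (K <= K')%N -> (forall p, prime p -> (p %| m)%N -> (p <= K)%N) ->
    G K' = G K.
  move=> KK pK; rewrite /G (@big_cat_nat _ _ _ K.+1) //= [X in _ + X]big1_seq ?addr0 //.
  move=> p /andP[_]; rewrite mem_index_iota => /andP[Kp _].
  exact: F0 (pK p) Kp.
have -> : \sum_(1 <= p < N.+1 | prime p) (logn p m)%:R * ln p%:R = G N.
  rewrite big_mkcond; apply: eq_bigr => p _; case: ifP => // pp.
  by rewrite lognE pp mul0r.
transitivity (G m); last first.
  have mm p : prime p -> (p %| m)%N -> (p <= m)%N by move=> _; exact: dvdn_leq.
  by rewrite -(GE _ _ (leq_maxl m N)) // (GE _ _ (leq_maxr m N)).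
have mE : m = (\prod_(1 <= p < m.+1) p ^ logn p m)%N.
  by rewrite -{1}(partnT m0) /partn big_ltn_cond //= [logn 0 m]lognE mul1n.
rewrite {1}mE natr_prod /G.
have : forall s : seq nat, all (leq 1) s ->
    ln (\prod_(p <- s) (p ^ logn p m)%:R) = \sum_(p <- s) (logn p m)%:R * ln p%:R :> R.
  elim=> [|p s IH]; first by rewrite !big_nil ln1.
  move=> /= /andP[p0 s0]; rewrite !big_cons lnM ?posrE ?ltr0n ?expn_gt0 ?p0 //; last first.
    rewrite big_seq prodr_gt0 // => q qs; rewrite ltr0n expn_gt0.
    by move/allP: s0 => ->.
  by rewrite natrX lnXn ?ltr0n // mulr_natl IH.
move=> ->; first by [].
by apply/allP => p; rewrite mem_index_iota => /andP[].
Qed.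

Lemma prime_ndvd_fact (p m : nat) : prime p -> (m < p)%N -> ~~ (p %| m`!)%N.
Proof.
move=> pp; elim: m => [|m IH] mp; first by rewrite dvdn1 neq_ltn prime_gt1 ?orbT.
rewrite factS Euclid_dvdM // negb_or IH ?(ltnW mp) // andbT.
by rewrite gtnNdvd.
Qed.

(* Every prime in (n - k, n] divides the binomial coefficient C(n, k), and
   ln C(n, k) <= k ln (e n / k). *)
Lemma sum_ln_prime_short (R : realType) (n k : nat) : (k.*2 <= n)%N ->
  \sum_((n - k).+1 <= p < n.+1 | prime p) ln p%:R <= 3 * Num.sqrt (k * n)%:R :> R.
Proof.
move=> kn; have [->|k0] := posnP k.
  by rewrite subn0 big_geq // mul0n sqrtr0 mulr0.
have kn' : (k <= n)%N by lia.
have C0 : (0 < 'C(n, k))%N by rewrite bin_gt0.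
have Ck := bin_fact kn'.
apply: (@le_trans _ _ (ln 'C(n, k)%:R)).
  rewrite (@ln_logn R 'C(n, k) n) //; last first.
    move=> p pp pC; rewrite leqNgt; apply/negP => np.
    by move: (prime_ndvd_fact pp np); rewrite -Ck dvdn_mulr.
  rewrite [leRHS](@big_cat_nat _ _ _ (n - k).+1) //=; last by rewrite ltnS leq_subr.
  rewrite -[leLHS]add0r lerD //.
    by apply: sumr_ge0 => p _; rewrite mulr_ge0 ?lnn_ge0.
  rewrite big_nat_cond [leRHS]big_nat_cond; apply: ler_sum => p /andP[/andP[np pn] pp].
  rewrite ler_peMl ?lnn_ge0 // ler1n logn_gt0 mem_primes pp C0 /=.
  have : (p %| n`!)%N by apply: dvdn_fact; rewrite prime_gt0.
  rewrite -Ck Euclid_dvdM // => /orP[//|]; rewrite Euclid_dvdM //.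
  rewrite (negbTE (prime_ndvd_fact _ np)) // orbF.
  by rewrite (negbTE (prime_ndvd_fact _ _)) //; lia.
have k0R : 0 < k%:R :> R by rewrite ltr0n.
have n0R : 0 < n%:R :> R by rewrite ltr0n; lia.
have : ln 'C(n, k)%:R <= k%:R * (ln n%:R - ln k%:R + 1) :> R.
  have : ln 'C(n, k)%:R + ln k`!%:R <= k%:R * ln n%:R :> R.
    rewrite -lnM ?posrE ?ltr0n ?fact_gt0 // -natrM bin_ffact.
    rewrite mulr_natl -lnXn // -natrX ler_lnn ?ffact_gt0 //.
    rewrite ffact_prod -[X in (_ <= _ ^ X)%N]card_ord -prod_nat_const.
    by apply: leq_prod => i _; exact: leq_subr.
  by have := ln_fact_ge R k; lra.
move/le_trans; apply.
rewrite -ln_div //.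
have := ln_le_2sqrt (divr_gt0 n0R k0R).
rewrite (sqrtrM _ (ltW n0R)) sqrtrV ?ler0n // natrM (sqrtrM _ (ltW k0R)).
have kE := sqr_sqrtr (ltW k0R).
have a0 : 0 < Num.sqrt k%:R :> R by rewrite sqrtr_gt0.
have ab : Num.sqrt k%:R <= Num.sqrt n%:R :> R by rewrite ler_sqrt // ler_nat.
move: (ln _) => l.
have -> : k%:R * (l + 1) = Num.sqrt k%:R ^+ 2 * (l + 1) by rewrite kE.
move: (Num.sqrt k%:R) (Num.sqrt n%:R) a0 ab => a b a0 ab lab.
(* Here a = sqrt k, b = sqrt n and l = ln (n / k): a^2 l <= 2 a b and a^2 <= a b add up to the
   constant 3. *)
have : a * l <= 2 * b.
  have -> : 2 * b = a * (2 * (b / a)) by field; rewrite lt0r_neq0.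
  by rewrite ler_pM2l.
by nra.
Qed.

(** Strong induction removing the upper half (n - k, n] with k = n / 2: it costs at most 3 sqrt (k
    n), which is at most 9 k because n <= 3 k. *)
Lemma theta_le (R : realType) (n : nat) :
  \sum_(1 <= p < n.+1 | prime p) ln p%:R <= 9 * n%:R :> R.
Proof.
elim/ltn_ind: n => n IH; have [n1|n2] := leqP n 1.
  rewrite big1_seq ?mulr_ge0 // => p /andP[pp]; rewrite mem_index_iota => /andP[_ pn].
  by have := prime_gt1 pp; lia.
pose k := n./2; have kn : (k.*2 <= n)%N by rewrite -[leqRHS]odd_double_half leq_addl.
have k1 : (0 < k)%N by rewrite half_gt0.
rewrite (@big_cat_nat _ _ _ (n - k).+1) //=; last by rewrite ltnS leq_subr.
apply: (le_trans (lerD (IH _ _) (sum_ln_prime_short R kn))); first by lia.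
have -> : n%:R = (n - k)%:R + k%:R :> R by rewrite -natrD subnK //; lia.
rewrite mulrDr lerD2l -[leRHS]ger0_norm ?mulr_ge0 // -sqrtr_sqr.
have -> : 3 = Num.sqrt (3 ^+ 2) :> R by rewrite sqrtr_sqr ger0_norm.
rewrite -sqrtrM ?ler_sqrt ?exprn_ge0 // -?natrX -?natrM ?ler_nat ?ler0n //.
have : (n <= 3 * k)%N by have := odd_double_half n; rewrite -/k -muln2; case: (odd n) => /=; lia.
by rewrite -natrX ler_nat -!mulnn; nia.
Qed.

Lemma logn_fact_ge (p n : nat) : prime p -> (0 < n)%N -> (n %/ p <= logn p n`!)%N.
Proof. by move=> pp n0; rewrite logn_fact // big_ltn // expn1 leq_addr. Qed.

Lemma logn_fact_le (R : realFieldType) (p n : nat) : prime p ->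
  (logn p n`!)%:R <= n%:R / (p%:R - 1) :> R.
Proof.
move=> pp; rewrite logn_fact // natr_sum.
have p1 : 1 < p%:R :> R by rewrite ltr1n prime_gt1.
have p0 : 0 < p%:R :> R by apply: lt_trans p1.
apply: (@le_trans _ _ (n%:R * \sum_(1 <= k < n.+1) p%:R ^- k)).
  rewrite mulr_sumr; apply: ler_sum => k _.
  rewrite ler_pdivlMr ?exprn_gt0 // -natrX -natrM ler_nat; exact: leq_divM.
rewrite ler_wpM2l //.
have -> : \sum_(1 <= k < n.+1) p%:R ^- k = (1 - p%:R ^- n) / (p%:R - 1) :> R.
  elim: n => [|n IH]; first by rewrite big_geq // expr0 invr1 subrr mul0r.
  rewrite big_nat_recr //= IH exprS; field.
  apply/and3P; split; rewrite ?subr_eq0 gt_eqF //.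
  exact: exprn_gt0.
by rewrite ler_pdivrMr ?subr_gt0 // mulVf ?subr_eq0 ?gt_eqF // gerBl.
Qed.

Definition mertens (R : realType) (n : nat) : R :=
  \sum_(1 <= p < n.+1 | prime p) ln p%:R / p%:R.

(** Comparison with ln n! <= n ln n: replacing n / p by its floor costs at most ln p for each prime,
    hence the 9 n of [theta_le]. *)
Lemma mertens_le (R : realType) (n : nat) : (0 < n)%N ->
  mertens R n <= ln n%:R + 9.
Proof.
move=> n0; have n0R : 0 < n%:R :> R by rewrite ltr0n.
rewrite -(ler_pM2l n0R) mulrDr.
have := ln_fact_le R n; rewrite (@ln_logn R n`! n) ?fact_gt0 //; last first.
  move=> p pp pn; rewrite leqNgt; apply/negP => np.
  by move: (prime_ndvd_fact pp np); rewrite pn.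
have := theta_le R n; rewrite [9 * _]mulrC => H1 H2.
apply: le_trans (lerD H2 H1); rewrite /mertens mulr_sumr -big_split /=.
apply: ler_sum => p pp; rewrite mulrCA mulrC -[X in _ + X]mul1r -mulrDl.
rewrite ler_wpM2r ?lnn_ge0 // natr1.
rewrite ler_pdivrMr ?ltr0n ?prime_gt0 // -natrM ler_nat.
apply: (@leq_trans ((n %/ p).+1 * p)%N).
  by rewrite ltnW // ltn_ceil // prime_gt0.
by rewrite leq_mul2r ltnS logn_fact_ge ?orbT.
Qed.

(** A telescoping majorant for ln p / (p (p - 1)): summed over all integers it gives at most 6, part
    of the constant lost in [mertens_ge]. *)
Lemma lnn_div_le (R : realType) (n : nat) : (0 < n)%N ->
  ln n.+1%:R / (n.+1%:R * n%:R) <= 6 * ((Num.sqrt n%:R)^-1 - (Num.sqrt n.+1%:R)^-1) :> R.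
Proof.
move=> n0; have n1R : 1 <= n%:R :> R by rewrite ler1n.
have := ln_le_2sqrt (ltr0Sn R n).
have a1 : 1 <= Num.sqrt n%:R :> R by rewrite -{1}sqrtr1 ler_sqrt // ltr0n.
have ab : Num.sqrt n%:R < Num.sqrt n.+1%:R :> R by rewrite ltr_sqrt ?ltr0n // ltr_nat.
have -> : n.+1%:R * n%:R = Num.sqrt n.+1%:R ^+ 2 * Num.sqrt n%:R ^+ 2 :> R.
  by rewrite !sqr_sqrtr.
have bE : Num.sqrt n.+1%:R ^+ 2 = 1 + Num.sqrt n%:R ^+ 2 :> R.
  by rewrite !sqr_sqrtr // nat1r.
move: (ln _) (Num.sqrt _) (Num.sqrt _) a1 ab bE => l b a a1 ab bE lb.
have a0 : 0 < a by lra.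
have b0 : 0 < b by lra.
rewrite ler_pdivrMr ?mulr_gt0 ?exprn_gt0 //.
have -> : 6 * (a^-1 - b^-1) * (b ^+ 2 * a ^+ 2) = 6 * (b - a) * (a * b).
  by field; rewrite !gt_eqF.
apply: (le_trans lb).
have : b <= 2 * a by nra.
have : (b - a) * (b + a) = 1 by rewrite -subr_sqr bE; ring.
move=> H1 H2; have H3 : 1 <= 3 * (a * (b - a)) by nra.
have : b * 1 <= b * (3 * (a * (b - a))) by rewrite ler_pM2l.
by nra.
Qed.

(** The bound ln n! >= n ln n - n loses 1; passing to p from p - 1, the denominator in the bound on
    the valuation of n!, loses 6. *)
Lemma mertens_ge (R : realType) (n : nat) : (0 < n)%N ->
  ln n%:R - 7 <= mertens R n.
Proof.
move=> n0; have n0R : 0 < n%:R :> R by rewrite ltr0n.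
have : n%:R * (ln n%:R - 1) <= n%:R * \sum_(1 <= p < n.+1 | prime p) ln p%:R / (p%:R - 1) :> R.
  rewrite mulrBr mulr1; apply: (le_trans (ln_fact_ge R n)).
  rewrite (@ln_logn R n`! n) ?fact_gt0 //; last first.
    move=> p pp pn; rewrite leqNgt; apply/negP => np.
    by move: (prime_ndvd_fact pp np); rewrite pn.
  rewrite mulr_sumr; apply: ler_sum => p pp.
  by rewrite mulrCA mulrC ler_wpM2l ?lnn_ge0 // logn_fact_le.
rewrite ler_pM2l // => H.
suff : \sum_(1 <= p < n.+1 | prime p) ln p%:R / (p%:R - 1) <= mertens R n + 6 by lra.
rewrite -lerBlDl /mertens -sumrB.
have E p : prime p -> ln p%:R / (p%:R - 1) - ln p%:R / p%:R = ln p%:R / (p%:R * p.-1%:R) :> R.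
  case: p => [|[|p]] //= _; rewrite -[p.+2%:R]natr1.
  have : 0 < p.+1%:R :> R by rewrite ltr0n.
  move: (p.+1%:R : R) => x x0; move: (ln _) => l; field.
  by rewrite !gt_eqF //; lra.
rewrite (eq_bigr _ E) big_mkcond /=.
rewrite big_ltn // add0r big_add1 /=.
apply: (@le_trans _ _ (\sum_(1 <= p < n) 6 * ((Num.sqrt p%:R)^-1 - (Num.sqrt p.+1%:R)^-1))).
  rewrite big_nat [leRHS]big_nat; apply: ler_sum => p /andP[p0 _].
  case: ifP => _; first exact: lnn_div_le.
  rewrite mulr_ge0 // subr_ge0 lef_pV2 ?posrE ?sqrtr_gt0 ?ltr0n //.
  by rewrite ler_sqrt ?ltr0n // ler_nat.
rewrite -mulr_sumr.
under eq_bigr do rewrite -opprB.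
rewrite sumrN telescope_sumr // sqrtr1 invr1 opprB.
have : 0 <= (Num.sqrt n%:R)^-1 :> R by rewrite invr_ge0 sqrtr_ge0.
by lra.
Qed.

Lemma mertens_block (R : realType) : exists2 C : nat, (1 < C)%N &
  forall n N, (0 < n)%N -> (C * n <= N)%N ->
  1 <= \sum_(n.+1 <= p < N.+1 | prime p) ln p%:R / p%:R :> R.
Proof.
(* 17 = 9 + 7 + 1: the constants of the two Mertens bounds plus the mass required of a block. *)
pose C := (Num.truncn (expR 17 : R)).+1.
have eC : expR 17 < C%:R :> R by apply: truncnS_gt.
have C17 : 17 <= ln C%:R :> R by rewrite -[leLHS]expRK ler_ln ?posrE ?expR_gt0 ?ltr0n // ltW.
exists C.
  rewrite ltnS -(ltr_nat R); have : ln C%:R != ln 1 :> R by rewrite ln1 gt_eqF //; lra.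
  by rewrite /C; case: (Num.truncn _) => //; rewrite eqxx.
move=> n N n0 CN.
have nN : (n <= N)%N by apply: leq_trans CN; rewrite leq_pmull.
have N0 : (0 < N)%N by apply: leq_trans nN.
have := mertens_ge R N0; have := mertens_le R n0.
have -> : mertens R N = mertens R n + \sum_(n.+1 <= p < N.+1 | prime p) ln p%:R / p%:R.
  by rewrite /mertens (@big_cat_nat _ _ _ n.+1).
have : ln C%:R + ln n%:R <= ln N%:R :> R.
  by rewrite -lnM ?posrE ?ltr0n // -natrM ler_lnn // muln_gt0 n0.
by lra.
Qed.

Lemma harmonic_ge (R : realType) (m n : nat) : (m <= n)%N ->
  ln n.+1%:R - ln m.+1%:R <= \sum_(m <= i < n) i.+1%:R^-1 :> R.
Proof.
move=> mn; rewrite -(telescope_sumr (fun i => ln i.+1%:R : R) mn).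
apply: ler_sum => i _; have i0 : 0 < i.+1%:R :> R by rewrite ltr0n.
rewrite -ln_div ?posrE ?ltr0n //.
have -> : i.+2%:R / i.+1%:R = 1 + i.+1%:R^-1 :> R.
  by rewrite -[i.+2%:R]natr1 mulrDl mulfV ?gt_eqF // mul1r addrC.
by rewrite le_ln1Dx // (lt_le_trans (ltrN10 R)) // invr_ge0 ler0n.
Qed.

(** Chebyshev's lower bound. Only the primes in (N / C, N] are used: their ln p / p sum to at least
    1, and each term is at most C ln N / N. *)
Lemma prime_count_ge (R : realType) : exists2 C : nat, (0 < C)%N &
  forall N, (C <= N)%N ->
  N%:R <= C%:R * (\sum_(1 <= p < N.+1 | prime p) 1) * ln N%:R :> R.
Proof.
have [C C1 HC] := mertens_block R; exists C; first by lia.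
move=> N CN; pose n := (N %/ C)%N.
have n0 : (0 < n)%N by rewrite divn_gt0 //; lia.
have nN : (n <= N)%N by apply: leq_div.
have /(HC n N n0) H : (C * n <= N)%N by rewrite mulnC leq_divM.
have {}H : n.+1%:R <= (\sum_(1 <= p < N.+1 | prime p) 1) * ln N%:R :> R.
  rewrite -[leLHS]mulr1; apply: (@le_trans _ _ (\sum_(n.+1 <= p < N.+1 | prime p) ln N%:R)).
    apply: (le_trans (ler_wpM2l (ler0n _ _) H)); rewrite mulr_sumr.
    rewrite big_nat_cond [leRHS]big_nat_cond; apply: ler_sum => p /andP[/andP[np pN] pp].
    have p0 : 0 < p%:R :> R by rewrite ltr0n prime_gt0.
    apply: (@le_trans _ _ (ln p%:R)); last by rewrite ler_lnn ?prime_gt0 //; lia.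
    by rewrite mulrCA ler_piMr ?lnn_ge0 // ler_pdivrMr // mul1r ler_nat.
  rewrite mulr_suml; under [leRHS]eq_bigr do rewrite mul1r.
  rewrite [leRHS](@big_cat_nat _ _ _ n.+1) //= lerDr.
  by apply: sumr_ge0 => *; apply: lnn_ge0.
rewrite -mulrA; apply: le_trans (ler_wpM2l (ler0n _ _) H).
by rewrite -natrM ler_nat mulnC ltnW // ltn_ceil //; lia.
Qed.

(** A window of relative length s^2 gets a bound of order s, by the square root in
    [sum_ln_prime_short]. What matters is that it vanishes with s, so that a fixed number of such
    windows can be made negligible. *)
Lemma prime_cluster_mass (R : realType) (s : R) (g w W : nat) :
  0 < s <= 2^-1 -> (1 < g)%N -> 1 <= s ^+ 2 * g%:R ->
  \sum_(w <= p < W | [&& prime p, (g <= p)%N & p%:R < (1 + s ^+ 2) * g%:R]) p%:R^-1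
  <= 6 * s / ln g%:R.
Proof.
move=> /andP[s0 s2] g1 sg.
have g0 : 0 < g%:R :> R by rewrite ltr0n; lia.
have s4 : s ^+ 2 <= 1 / 4 by nra.
have lg0 : 0 < ln g%:R :> R by rewrite ln_gt0 // ltr1n.
have n0 : 0 <= (1 + s ^+ 2) * g%:R by rewrite mulr_ge0 ?(ltW g0) // addr_ge0 // sqr_ge0.
have [n /andP[nl nu]] : exists n : nat, n%:R <= (1 + s ^+ 2) * g%:R < n.+1%:R.
  by exists (Num.truncn ((1 + s ^+ 2) * g%:R)); apply: truncn_itv.
have gn : (g <= n)%N.
  by rewrite -ltnS -(ltr_nat R); apply: le_lt_trans nu; nra.
(* The interval (n - k, n] then starts exactly at g; 1 <= s^2 g absorbs the extra 1 into k <= 2 s^2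
   g. *)
pose k := (n - g.-1)%N.
have kR : k%:R <= 2 * s ^+ 2 * g%:R.
  rewrite /k natrB; last by lia.
  by rewrite -subn1 natrB; [lra | lia].
have kn : (k.*2 <= n)%N.
  rewrite -(ler_nat R) -mul2n natrM; apply: (@le_trans _ _ g%:R); last by rewrite ler_nat.
  have : 0 <= (1 / 4 - s ^+ 2) * g%:R by rewrite mulr_ge0 ?subr_ge0 // ltW.
  by move: kR; rewrite mulrBl; lra.
have nk : (n - k).+1 = g by rewrite /k; lia.
have := sum_ln_prime_short R kn; rewrite nk => H.
have S : Num.sqrt (k * n)%:R <= 2 * s * g%:R :> R.
  have sg0 : 0 <= 2 * s * g%:R by rewrite !mulr_ge0 // ltW.
  rewrite -(ger0_norm sg0) -sqrtr_sqr ler_sqrt ?sqr_ge0 // natrM.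
  have : n%:R <= 2 * g%:R :> R by apply: (le_trans nl); nra.
  have := ler0n R k; have := ler0n R n; move: (n%:R) (k%:R) (g%:R) g0 kR => a b c.
  move=> c0 bc a0 b0 ac.
  by apply: (le_trans (ler_pM b0 a0 bc ac)); rewrite !expr2; lra.
rewrite ler_pdivlMr // -(ler_pM2l g0).
apply: (@le_trans _ _ (\sum_(g <= p < n.+1 | prime p) ln p%:R)); last first.
  by apply: (le_trans H); lra.
rewrite mulr_suml mulr_sumr.
rewrite [leRHS](big_nat_widenl _ 0) // [leRHS](big_nat_widen _ _ (maxn W n.+1)) ?leq_maxr //.
rewrite [leLHS](big_nat_widenl _ 0) // [leLHS](big_nat_widen _ _ (maxn W n.+1)) ?leq_maxl //.
rewrite big_mkcond [leRHS]big_mkcond /=; apply: ler_sum => p _.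
case: ifP; last by case: ifP => _; rewrite ?lnn_ge0.
move=> /andP[/andP[/and3P[pp gp pg] wp] pW].
have p0 : 0 < p%:R :> R by apply: lt_le_trans g0 _; rewrite ler_nat.
have pn : (p < n.+1)%N.
  by rewrite -(ltr_nat R); apply: lt_trans nu.
rewrite pp gp pn /=; apply: (@le_trans _ _ (ln g%:R)); last by apply: ler_lnn => //; apply: ltnW.
by rewrite mulrA ler_piMl ?(ltW lg0) // ler_pdivrMr // mul1r ler_nat.
Qed.

(** * Primes at controlled ratios *)

(* The elements of G in [y, (1 + eta) y) all lie within a factor 1 + s^2 of the
   smallest one. *)
Lemma prime_gap_free_mass (R : realType) (s eta y : R) (w W : nat) (G : pred nat) :
  0 < s <= 2^-1 -> 1 < y -> 1 <= s ^+ 2 * y ->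
  (forall p q, prime p -> prime q -> (w <= p)%N -> (q < W)%N -> G p -> G q ->
    (1 + s ^+ 2) * p%:R <= q%:R -> (1 + eta) * p%:R < q%:R :> R) ->
  0 <= eta ->
  \sum_(w <= p < W | [&& prime p, G p, y <= p%:R & p%:R < (1 + eta) * y]) p%:R^-1
  <= 6 * s / ln y.
Proof.
move=> s02 y1 sy nopair eta0; have /andP[s0 _] := s02.
have ly0 : 0 < ln y by rewrite ln_gt0.
pose P p := [&& prime p, G p, y <= p%:R & p%:R < (1 + eta) * y].
have [/hasP[g0 g0wW Pg0]|nP] := boolP (has P (index_iota w W)); last first.
  by rewrite big_hasC // divr_ge0 ?mulr_ge0 // ltW.
have exP : exists n, (n \in index_iota w W) && P n by exists g0; rewrite g0wW.
case: (ex_minnP exP) => g /andP[gwW Pg] gmin {g0 g0wW Pg0}.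
have /and4P[gp gG yg gy] := Pg.
have g1R : 1 < g%:R :> R by apply: lt_le_trans yg.
have g1 : (1 < g)%N by rewrite -(ltr_nat R).
have sg : 1 <= s ^+ 2 * g%:R by apply: (le_trans sy); rewrite ler_wpM2l ?sqr_ge0.
have := prime_cluster_mass w W s02 g1 sg.
have H : 6 * s / ln g%:R <= 6 * s / ln y.
  rewrite ler_wpM2l ?mulr_ge0 ?(ltW s0) // lef_pV2 ?posrE ?ln_gt0 //.
  by rewrite ler_ln ?posrE //; lra.
move=> H1; apply: le_trans H; apply: le_trans H1.
rewrite big_seq_cond [leRHS]big_seq_cond big_mkcond [leRHS]big_mkcond /=.
apply: ler_sum => p _; case: ifP => [/andP[pwW Pp]|_]; last by case: ifP; rewrite ?invr_ge0.
have gp' : (g <= p)%N by apply: gmin; rewrite pwW.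
have /and4P[pp pG yp py] := Pp.
rewrite ifT // pwW pp gp' /= ltNge; apply/negP => H2.
have := nopair _ _ gp pp _ _ gG pG H2.
move: gwW pwW; rewrite !mem_index_iota => /andP[wg _] /andP[_ pW] /(_ wg pW).
have : (1 + eta) * y <= (1 + eta) * g%:R by rewrite ler_wpM2l //; lra.
by lra.
Qed.

Lemma prime_gap_free_mass_iter (R : realType) (s eta y : R) (w W Q : nat) (G : pred nat) :
  0 < s <= 2^-1 -> 1 < y -> 1 <= s ^+ 2 * y ->
  (forall p q, prime p -> prime q -> (w <= p)%N -> (q < W)%N -> G p -> G q ->
    (1 + s ^+ 2) * p%:R <= q%:R -> (1 + eta) * p%:R < q%:R :> R) ->
  0 <= eta ->
  \sum_(w <= p < W | [&& prime p, G p, y <= p%:R & p%:R < (1 + eta) ^+ Q * y]) p%:R^-1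
  <= Q%:R * (6 * s / ln y).
Proof.
move=> s02 y1 sy nopair eta0; have /andP[s0 _] := s02.
have ly0 : 0 < ln y by rewrite ln_gt0.
elim: Q => [|Q IH].
  rewrite mul0r big1 // => p /and4P[_ _ yp]; rewrite expr0 mul1r => py.
  by have := lt_le_trans py yp; rewrite ltxx.
pose z := (1 + eta) ^+ Q * y.
have yz : y <= z by rewrite /z ler_peMl ?exprn_ege1 //; lra.
have z1 : 1 < z by apply: lt_le_trans yz.
have sz : 1 <= s ^+ 2 * z by apply: (le_trans sy); rewrite ler_wpM2l ?sqr_ge0.
have := prime_gap_free_mass s02 z1 sz nopair eta0.
have H : 6 * s / ln z <= 6 * s / ln y.
  rewrite ler_wpM2l ?mulr_ge0 ?(ltW s0) // lef_pV2 ?posrE ?ln_gt0 //.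
  by rewrite ler_ln ?posrE //; lra.
move=> /le_trans /(_ H) {}H.
rewrite -natr1 mulrDl mul1r; apply: le_trans (lerD IH H).
rewrite big_mkcond [X in _ <= X + _]big_mkcond [X in _ <= _ + X]big_mkcond -big_split /=.
apply: ler_sum => p _; rewrite -/z.
have p0 : 0 <= p%:R^-1 :> R by rewrite invr_ge0.
case: (boolP (prime p)) => pp /=; last by rewrite addr0.
case: (boolP (G p)) => pG /=; last by rewrite addr0.
case: (boolP (y <= p%:R)) => yp /=; last first.
  by case: ifP => _; rewrite ?addr0 ?add0r.
rewrite exprS -mulrA -/z.
have [pz|zp] := ltP p%:R z; last by rewrite add0r.
by rewrite (lt_le_trans pz) /= ?addr0 // ler_peMl //; lra.
Qed.

(* If no block [C^i, C^(i+1)) contained a good pair, G would have less than half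
   of the mass of each block. *)
Lemma prime_blocks_spread (R : realType) (eta : R) : 0 < eta ->
  exists s : R, [/\ 0 < s, s <= 2^-1 & exists2 w : nat, (2 < w)%N & forall B : R,
    exists2 W : nat, B <= \sum_(w <= p < W | prime p) p%:R^-1 &
    forall G : pred nat,
      \sum_(w <= p < W | prime p && ~~ G p) p%:R^-1 <
        2^-1 * \sum_(w <= p < W | prime p) p%:R^-1 :> R ->
      exists p q : nat, [/\ prime p, prime q, (w <= p)%N && (q < W)%N, G p && G q &
        (1 + s ^+ 2) * p%:R <= q%:R <= (1 + eta) * p%:R]].
Proof.
move=> eta0; have [C C1 HC] := mertens_block R.
have C1R : 1 < C%:R :> R by rewrite ltr1n.
have C0 : (0 < C)%N by apply: ltnW.
pose c : R := ln C%:R; have c0 : 0 < c by rewrite /c ln_gt0.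
(* Q windows of ratio 1 + eta cover a block [C^i, C^(i+1)). Q depends on eta and C only, so that s
   can be chosen after it. *)
have [Q CQ] : exists Q, C%:R <= (1 + eta) ^+ Q.
  exists (Num.truncn (C%:R / eta)).+1.
  apply: (@le_trans _ _ (1 + eta *+ (Num.truncn (C%:R / eta)).+1)).
    have := truncnS_gt (C%:R / eta); rewrite ltr_pdivrMr // mulr_natl; lra.
  move: (_.+1) => n; elim: n => [|n IH]; first by rewrite mulr0n expr0 addr0.
  rewrite exprS mulrS; have : 0 <= eta *+ n by rewrite mulrn_wge0 // ltW.
  by nra.
(* Makes Q * 6 s <= 1/4: in block i the primes of G then have mass at most 1 / (4 i c), while the
   block has mass at least 1 / ((i + 1) c) >= 1 / (2 i c). *)
pose s : R := (24 * Q.+1%:R)^-1.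
have Q0 : 0 < Q.+1%:R :> R by rewrite ltr0n.
have s0 : 0 < s by rewrite invr_gt0 mulr_gt0.
have Qs : Q%:R * (6 * s) <= 4^-1.
  have : s * (24 * Q.+1%:R) = 1 by rewrite mulVf // mulf_neq0 ?gt_eqF.
  by rewrite -natr1; nra.
have s2 : s <= 2^-1 by rewrite lef_pV2 ?posrE ?mulr_gt0 //; move: Q0; rewrite -natr1; have := ler0n R Q; lra.
exists s; split=> //.
have [i0 i02 i0s] : exists2 i0, (2 < i0)%N & s ^- 2 <= i0%:R.
  exists (Num.truncn (s ^- 2)).+3 => //; apply: le_trans (ltW (truncnS_gt _)) _.
  by rewrite ler_nat !ltnS ltnW.
have Ci (i : nat) : (i <= C ^ i)%N by apply: ltnW; apply: ltn_expl.
have i0P i : (i0 <= i)%N -> 1 <= s ^+ 2 * (C ^ i)%:R.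
  move=> ii; have s20 : 0 < s ^+ 2 by rewrite exprn_gt0.
  rewrite -[leLHS](mulfV (lt0r_neq0 s20)) ler_pM2l //; apply: (le_trans i0s).
  by rewrite ler_nat (leq_trans ii) // Ci.
exists (C ^ i0)%N; first exact: leq_trans (Ci i0).
pose mass (P : pred nat) i : R := \sum_(C ^ i <= p < C ^ i.+1 | P p) p%:R^-1.
have massE P I : (i0 <= I)%N ->
    \sum_(C ^ i0 <= p < C ^ I | P p) p%:R^-1 = \sum_(i0 <= i < I) mass P i.
  move=> /subnKC <-; elim: (I - i0)%N => [|k IH]; first by rewrite addn0 !big_geq.
  rewrite addnS [RHS]big_nat_recr ?leq_addr //= -IH.
  by rewrite (@big_cat_nat _ _ _ (C ^ (i0 + k))) //= leq_pexp2l // ?leq_addr.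
have mass_ge i : (i0 <= i)%N -> (i.+1%:R * c)^-1 <= mass prime i.
  move=> ii; have i1 : (0 < (C ^ i).-1)%N.
    by move: i02 ii (Ci i); clear; lia.
  have := HC (C ^ i).-1 (C ^ i.+1).-1 i1.
  have Ci0 j : (0 < C ^ j)%N by rewrite expn_gt0 C0.
  rewrite !prednK // => /(_ _) H.
  have {}H : 1 <= \sum_(C ^ i <= p < C ^ i.+1 | prime p) ln p%:R / p%:R :> R.
    apply: H; rewrite expnS; have := Ci0 i; move: (C ^ i)%N C0 => m; clear; nia.
  have ic0 : 0 < i.+1%:R * c by rewrite mulr_gt0 // ltr0n.
  rewrite -[leLHS]mulr1 mulrC ler_pdivrMr // (le_trans H) // mulr_suml.
  rewrite big_nat_cond [leRHS]big_nat_cond; apply: ler_sum => p /andP[/andP[ip pi] pp].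
  rewrite mulrC ler_wpM2l ?invr_ge0 // mulr_natl /c -lnXn; last by rewrite ltr0n.
  by rewrite -natrX ler_lnn ?prime_gt0 // ltnW.
(* The block masses dominate a harmonic series, so the total passes any B. *)
move=> B; have [I iI IB] : exists2 I, (i0 <= I)%N & c * B + ln i0.+1%:R <= ln I.+1%:R.
  exists (maxn i0 (Num.truncn (expR (c * B + ln i0.+1%:R)))); first exact: leq_maxl.
  rewrite -[leLHS]expRK ler_ln ?posrE ?expR_gt0 ?ltr0n //.
  apply: le_trans (ltW (truncnS_gt _)) _; rewrite ler_nat ltnS; exact: leq_maxr.
exists (C ^ I)%N.
  rewrite massE //; apply: (@le_trans _ _ (\sum_(i0 <= i < I) i.+1%:R^-1 / c)); last first.
    rewrite big_nat [leRHS]big_nat; apply: ler_sum => i /andP[ii _].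
    by rewrite -invfM mass_ge.
  rewrite -mulr_suml ler_pdivlMr //; apply: le_trans (harmonic_ge R iI).
  by rewrite lerBrDr mulrC.
move=> G Gbad; apply: contrapT => npair; move: Gbad; apply/negP; rewrite -leNgt.
rewrite !massE // mulr_sumr big_nat [leRHS]big_nat; apply: ler_sum => i /andP[ii iI'].
have massD : mass prime i = mass (fun p => prime p && G p) i + mass (fun p => prime p && ~~ G p) i.
  by rewrite /mass (bigID G).
suff : mass (fun p => prime p && G p) i <= 2^-1 * mass prime i by lra.
pose y : R := (C ^ i)%:R.
have y1 : 1 < y by rewrite ltr1n; apply: leq_trans (Ci i); apply: leq_trans ii; apply: ltnW.
have CiI : (C ^ i0 <= C ^ i)%N by rewrite leq_pexp2l.
have CIi : (C ^ i.+1 <= C ^ I)%N by rewrite leq_pexp2l.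
have := @prime_gap_free_mass_iter R s eta y (C ^ i) (C ^ i.+1) Q G _ y1 (i0P _ ii) _ (ltW eta0).
rewrite s0 s2 => /(_ isT).
have np p q : prime p -> prime q -> (C ^ i <= p)%N -> (q < C ^ i.+1)%N -> G p -> G q ->
    (1 + s ^+ 2) * p%:R <= q%:R -> (1 + eta) * p%:R < q%:R.
  move=> pp qp ip qi pG qG pq; rewrite ltNge; apply/negP => qp'.
  apply: npair; exists p, q; split=> //; rewrite ?pG ?qG ?pq ?qp' //.
  by rewrite (leq_trans CiI ip) (leq_trans qi CIi).
move=> /(_ np) {np}.
have -> : \sum_(C ^ i <= p < C ^ i.+1 | [&& prime p, G p, y <= p%:R & p%:R < (1 + eta) ^+ Q * y])
   p%:R^-1 = mass (fun p => prime p && G p) i.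
  rewrite /mass big_nat_cond [RHS]big_nat_cond; apply: eq_bigl => p.
  case: (boolP (C ^ i <= p < C ^ i.+1)%N) => //= /andP[ip pi].
  rewrite /y ler_nat ip; case: prime => //=; case: (G p) => //=.
  apply: (@lt_le_trans _ _ (C ^ i.+1)%:R); first by rewrite ltr_nat.
  by rewrite expnS natrM ler_wpM2r.
move/le_trans; apply; apply: le_trans (ler_wpM2l _ (mass_ge _ ii)); last by rewrite invr_ge0.
rewrite mulrA /y natrX lnXn; last by rewrite ltr0n.
rewrite -/c -[c *+ i]mulr_natl.
have i1 : 1 <= i%:R :> R by rewrite ler1n; apply: leq_trans ii; do 2 apply: ltnW.
have iR0 : 0 < i%:R :> R by lra.
have ic0 : 0 < i%:R * c by rewrite mulr_gt0.
apply: (@le_trans _ _ (4^-1 / (i%:R * c))).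
  by rewrite ler_wpM2r // invr_ge0 ltW.
have jc0 : 0 < i.+1%:R * c by rewrite mulr_gt0 ?ltr0n.
rewrite -!invfM lef_pV2 ?posrE ?mulr_gt0 //.
by rewrite -[i.+1%:R]natr1; nra.
Qed.

(** * The Turan-Kubilius inequality *)

Lemma sum_dvdn (R : pzSemiRingType) (d N : nat) : (0 < d)%N ->
  \sum_(1 <= n < N.+1) (d %| n)%:R = (N %/ d)%:R :> R.
Proof.
move=> d0; rewrite (eq_bigr (fun n => if (d %| n)%N then 1 else 0)); last first.
  by move=> n _; case: (d %| n)%N.
by rewrite -big_mkcond sum_multiples // sumr_const_nat subn1.
Qed.

Lemma divn_itv (R : realFieldType) (N d : nat) : (0 < d)%N ->
  (N%:R / d%:R - 1 : R) <= (N %/ d)%:R <= (N%:R / d%:R : R).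
Proof.
move=> d0; have d0R : 0 < d%:R :> R by rewrite ltr0n.
rewrite lerBlDr natr1 ler_pdivrMr // ler_pdivlMr // -!natrM !ler_nat leq_divM andbT.
exact/ltnW/ltn_ceil.
Qed.

(** Divisibility by p and divisibility by q are independent up to rounding: for p != q the main
    terms N / (p q) cancel and the floors leave a bounded error; for p = q a variance of at most N /
    p is added. *)
Lemma prime_correlation (R : realFieldType) (N p q : nat) : prime p -> prime q ->
  `|\sum_(1 <= n < N.+1) ((p %| n)%:R - p%:R^-1) * ((q %| n)%:R - q%:R^-1)|
  <= 2 + (if p == q then N%:R / p%:R else 0) :> R.
Proof.
move=> pp pq.
have p0 := prime_gt0 pp; have q0 := prime_gt0 pq.
have pR : 2 <= p%:R :> R by rewrite (ler_nat R 2) prime_gt1.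
have qR : 2 <= q%:R :> R by rewrite (ler_nat R 2) prime_gt1.
have p'0 : 0 < p%:R^-1 :> R by rewrite invr_gt0; lra.
have q'0 : 0 < q%:R^-1 :> R by rewrite invr_gt0; lra.
have p'2 : p%:R^-1 <= 2^-1 :> R by rewrite lef_pV2 ?posrE //; lra.
have q'2 : q%:R^-1 <= 2^-1 :> R by rewrite lef_pV2 ?posrE //; lra.
have -> : \sum_(1 <= n < N.+1) ((p %| n)%:R - p%:R^-1) * ((q %| n)%:R - q%:R^-1) =
   \sum_(1 <= n < N.+1) ((p %| n)%:R * (q %| n)%:R) - (N %/ p)%:R / q%:R
   - (N %/ q)%:R / p%:R + N%:R / p%:R / q%:R :> R.
  rewrite -!(sum_dvdn R) // !mulr_suml -!sumrB.
  have -> : N%:R / p%:R / q%:R = \sum_(1 <= n < N.+1) (p%:R^-1 / q%:R) :> R.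
    by rewrite sumr_const_nat subn1 -[RHS]mulr_natl mulrA.
  by rewrite -big_split /=; apply: eq_bigr => n _; ring.
have /andP[p1 p2] := divn_itv R N p0; have /andP[q1 q2] := divn_itv R N q0.
have N0 : 0 <= N%:R :> R by [].
case: eqVneq => [qE|pq'].
  rewrite -qE in q1 q2 *.
  have -> : \sum_(1 <= n < N.+1) ((p %| n)%:R * (p %| n)%:R) = (N %/ p)%:R :> R.
    rewrite -(sum_dvdn R) //; apply: eq_bigr => n _.
    by case: (p %| n)%N; rewrite ?mulr1 ?mulr0.
  move: p1 p2 p'0 p'2 N0; move: (N%:R) (p%:R^-1) ((N %/ p)%:R) => x a b p1 p2 a0 a2 x0.
  have xa0 : 0 <= x * a by rewrite mulr_ge0 // ltW.
  have H1 : 0 <= (x * a - b) * (1 - 2 * a) by apply: mulr_ge0; lra.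
  have H2 : 0 <= (b + 1) * (1 - 2 * a) by apply: mulr_ge0; lra.
  have H3 : 0 <= x * a * a by rewrite !mulr_ge0 // ltW.
  by rewrite ler_norml; apply/andP; split; lra.
have -> : \sum_(1 <= n < N.+1) ((p %| n)%:R * (q %| n)%:R) = (N %/ (p * q))%:R :> R.
  rewrite -(sum_dvdn R) ?muln_gt0 ?p0 //; apply: eq_bigr => n _.
  rewrite Gauss_dvd; last by rewrite prime_coprime // dvdn_prime2.
  by case: (p %| n)%N; rewrite ?mul1r ?mul0r.
have pq0 : (0 < p * q)%N by rewrite muln_gt0 p0.
have /andP[] := divn_itv R N pq0.
rewrite natrM invfM addr0.
move: p1 p2 q1 q2 N0 p'0 q'0 p'2 q'2.
move: (N%:R) (p%:R^-1) (q%:R^-1) ((N %/ p)%:R) ((N %/ q)%:R) ((N %/ (p * q))%:R) => x a b u v t.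
move=> p1 p2 q1 q2 x0 a0 b0 a2 b2 t1 t2.
have H1 : 0 <= (x * a - u) * b by apply: mulr_ge0; lra.
have H2 : 0 <= (u - (x * a - 1)) * b by apply: mulr_ge0; lra.
have H3 : 0 <= (x * b - v) * a by apply: mulr_ge0; lra.
have H4 : 0 <= (v - (x * b - 1)) * a by apply: mulr_ge0; lra.
by rewrite ler_norml; apply/andP; split; lra.
Qed.

(* Duality: with signs e_p absorbing the absolute values, Cauchy-Schwarz reduces
   the bound to the second moment of the sum of e_p (1_(p | n) - 1 / p). *)
Lemma turan_kubilius (R : realFieldType) (g : nat -> R) (w W N : nat) (T : R) :
  (forall n, `|g n| <= 1) -> 0 < T -> \sum_(w <= p < W | prime p) p%:R^-1 + 1 <= T ^+ 2 ->
  (2 * W * W <= N)%N ->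
  \sum_(w <= p < W | prime p)
    `|\sum_(1 <= n < N.+1 | (p %| n)%N) g n - (\sum_(1 <= n < N.+1) g n) / p%:R|
  <= N%:R * T.
Proof.
move=> g1 T0 LT WN.
pose a p n : R := (p %| n)%:R - p%:R^-1.
pose x p : R := \sum_(1 <= n < N.+1) g n * a p n.
have -> : \sum_(w <= p < W | prime p)
    `|\sum_(1 <= n < N.+1 | (p %| n)%N) g n - (\sum_(1 <= n < N.+1) g n) / p%:R| =
  \sum_(w <= p < W | prime p) Num.sg (x p) * x p.
  apply: eq_bigr => p _; rewrite -normrEsg; congr `|_|.
  rewrite big_mkcond mulr_suml -sumrB; apply: eq_bigr => n _.
  by rewrite /a; case: (p %| n)%N; rewrite ?mulrBr ?mulr1 ?mulr0.
pose h n : R := \sum_(w <= p < W | prime p) Num.sg (x p) * a p n.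
have -> : \sum_(w <= p < W | prime p) Num.sg (x p) * x p = \sum_(1 <= n < N.+1) g n * h n.
  under eq_bigr do rewrite mulr_sumr.
  rewrite exchange_big /=; apply: eq_bigr => n _.
  by rewrite mulr_sumr; apply: eq_bigr => p _; rewrite mulrCA.
have h2 : \sum_(1 <= n < N.+1) h n ^+ 2 <= N%:R * T ^+ 2.
  have -> : \sum_(1 <= n < N.+1) h n ^+ 2 = \sum_(w <= p < W | prime p)
     \sum_(w <= q < W | prime q) Num.sg (x p) * Num.sg (x q) *
        \sum_(1 <= n < N.+1) a p n * a q n.
    under [RHS]eq_bigr do under eq_bigr do rewrite mulr_sumr.
    under [RHS]eq_bigr do rewrite exchange_big /=.
    rewrite [RHS]exchange_big /=; apply: eq_bigr => n _.
    rewrite expr2 {1}/h mulr_suml; apply: eq_bigr => p _.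
    by rewrite mulr_sumr; apply: eq_bigr => q _; ring.
  (* The diagonal gives the terms N / p; the rounding error 2 for each of at most W^2 pairs is
     absorbed by 2 W^2 <= N. *)
  apply: (@le_trans _ _ (\sum_(w <= p < W | prime p) (N%:R / p%:R + 2 * W%:R))).
    rewrite big_nat_cond [leRHS]big_nat_cond; apply: ler_sum => p /andP[wpW pp].
    have -> : N%:R / p%:R = \sum_(w <= q < W | prime q) if q == p then N%:R / p%:R else 0 :> R.
      by rewrite -big_mkcondr big_nat1_cond_eq wpW pp.
    apply: (@le_trans _ _ (\sum_(w <= q < W | prime q) (2 + if q == p then N%:R / p%:R else 0))).
      apply: ler_sum => q pq; apply: le_trans (ler_norm _) _.
      rewrite !normrM; apply: le_trans (_ : 1 * _ <= _).
        apply: ler_wpM2r => //; rewrite !normr_sg -natrM lern1.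
        by case: (x p == 0); case: (x q == 0).
      by rewrite mul1r eq_sym; apply: prime_correlation.
    rewrite big_split /= addrC lerD2l.
    apply: (@le_trans _ _ (\sum_(0 <= q < W) 2)).
      rewrite [leLHS](big_nat_widenl _ 0) // big_mkcond /=.
      by apply: ler_sum => q _; case: ifP.
    by rewrite sumr_const_nat subn0 mulr_natr.
  rewrite big_split /= -mulr_sumr.
  apply: (@le_trans _ _ (N%:R * (\sum_(w <= p < W | prime p) p%:R^-1) + N%:R)).
    rewrite lerD2l; apply: (@le_trans _ _ (\sum_(0 <= q < W) (2 * W%:R))).
      rewrite [leLHS](big_nat_widenl _ 0) // big_mkcond /=.
      by apply: ler_sum => q _; case: ifP; rewrite // mulr_ge0.
    by rewrite sumr_const_nat subn0 -[leLHS]mulr_natr -!natrM ler_nat.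
  by rewrite -[X in _ + X]mulr1 -mulrDr ler_wpM2l.
(* Cauchy-Schwarz in the pointwise form |h| <= (h^2 / T + T) / 2. *)
apply: (@le_trans _ _ (\sum_(1 <= n < N.+1) (T^-1 * h n ^+ 2 + T) / 2)).
  apply: ler_sum => n _; apply: le_trans (ler_norm _) _.
  rewrite normrM; apply: (@le_trans _ _ (1 * `|h n|)); first by apply: ler_wpM2r.
  rewrite mul1r -[h n ^+ 2]real_normK ?num_real //; move: (`|h n|) => y.
  have : 0 <= T^-1 * (y - T) ^+ 2 by rewrite mulr_ge0 ?sqr_ge0 // invr_ge0 ltW.
  have -> : T^-1 * (y - T) ^+ 2 = T^-1 * y ^+ 2 + T - 2 * y.
    by field; rewrite gt_eqF.
  by lra.
rewrite -mulr_suml big_split /= -mulr_sumr sumr_const_nat subn1 /= -[T *+ N]mulr_natl.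
have : T^-1 * (\sum_(1 <= n < N.+1) h n ^+ 2) <= T^-1 * (N%:R * T ^+ 2).
  by rewrite ler_wpM2l // invr_ge0 ltW.
have -> : T^-1 * (N%:R * T ^+ 2) = N%:R * T by field; rewrite gt_eqF.
by lra.
Qed.

(** The function M of the overview, a twisted Mertens function; [mertens] is instead the prime sum
    of ln p / p. *)
Definition tmertens (R : pzRingType) (N : nat) : R := \sum_(1 <= n < N.+1) tmoebius R n.

Lemma tmertens_dist (R : numDomainType) (m n : nat) : (m <= n)%N ->
  `|tmertens R n - tmertens R m| <= (n - m)%:R.
Proof.
move=> mn; rewrite /tmertens (@big_cat_nat _ _ _ m.+1) //= addrAC subrr add0r.
apply: (le_trans (ler_norm_sum _ _ _)).
apply: (@le_trans _ _ (\sum_(m.+1 <= i < n.+1) 1)).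
  by apply: ler_sum => i _; exact: normr_tmoebius_le1.
by rewrite sumr_const_nat subSS.
Qed.

Lemma normr_tmertens_le (R : numDomainType) (n : nat) : `|tmertens R n| <= n%:R.
Proof. by have := tmertens_dist R (leq0n n); rewrite {2}/tmertens big_geq // subr0 subn0. Qed.

Lemma tmoebius_mulp (R : comPzRingType) (p n : nat) : prime p -> (0 < n)%N ->
  tmoebius R (p * n) = if (p %| n)%N then 0 else - (chi4 R p * tmoebius R n).
Proof.
move=> pp n0; rewrite /tmoebius moebius_mulp // chi4M.
by case: ifP => _; rewrite ?mul0r // mulNr mulrCA.
Qed.

(** For f = mu chi, f(p c) = -chi(p) f(c) unless p divides c, and at most N / p^2 values of c are
    exceptional. *)
Lemma sum_tmoebius_multiples (R : realFieldType) (p N : nat) : prime p ->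
  `|\sum_(1 <= n < N.+1 | (p %| n)%N) tmoebius R n + chi4 R p * tmertens R (N %/ p)|
  <= N%:R / p%:R ^+ 2.
Proof.
move=> pp; have p0 := prime_gt0 pp.
rewrite sum_multiples // /tmertens mulr_sumr -big_split /=.
rewrite (@eq_big_nat _ _ _ _ _ _
    (fun c => if (p %| c)%N then chi4 R p * tmoebius R c else 0)); last first.
  move=> c /andP[c0 _]; rewrite tmoebius_mulp //.
  by case: ifP => _; rewrite ?add0r ?addNr.
apply: (le_trans (ler_norm_sum _ _ _)).
apply: (@le_trans _ _ (\sum_(1 <= c < (N %/ p).+1) (p %| c)%:R)).
  apply: ler_sum => c _; case: ifP => _; last by rewrite normr0.
  rewrite normrM -[leRHS]mulr1 ler_pM //; last exact: normr_tmoebius_le1.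
  by rewrite normr_chi4 lern1 leq_b1.
rewrite sum_dvdn //.
have /andP[_ /le_trans] := divn_itv R (N %/ p) p0; apply.
rewrite expr2 invfM mulrA ler_wpM2r ?invr_ge0 //.
by have /andP[] := divn_itv R N p0.
Qed.

Lemma sum_inv_sqr_le (R : realFieldType) (m n : nat) : (1 < m)%N ->
  \sum_(m <= p < n | prime p) p%:R ^- 2 <= 1 :> R.
Proof.
move=> m1; have [mn|nm] := leqP m n; last by rewrite big_geq // ltnW.
apply: (@le_trans _ _ (\sum_(m <= p < n) (- p.+1.-1%:R^-1 - (- p.-1%:R^-1)))).
  rewrite big_mkcond big_nat [leRHS]big_nat; apply: ler_sum => p /andP[mp _].
  have [k pE] : exists k, p = k.+2 by exists p.-2; lia.
  rewrite {}pE {p mp} /= opprK addrC.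
  have -> : k.+1%:R^-1 - k.+2%:R^-1 = (k.+1%:R * k.+2%:R)^-1 :> R.
    rewrite -[k.+2%:R]natr1; have : 0 < k.+1%:R :> R by rewrite ltr0n.
    move: (k.+1%:R : R) => x x0; field; rewrite !gt_eqF //; lra.
  have k0 : 0 < (k.+1%:R * k.+2%:R)^-1 :> R by rewrite invr_gt0 mulr_gt0 ?ltr0n.
  case: ifP => _; last exact: ltW.
  by rewrite lef_pV2 ?posrE ?mulr_gt0 ?exprn_gt0 ?ltr0n // expr2 ler_wpM2r // ler_nat.
rewrite (telescope_sumr (fun i => - i.-1%:R^-1)) // opprK addrC lerBlDr.
apply: (@le_trans _ _ 1); last by rewrite lerDl invr_ge0.
by rewrite invf_le1 ?ltr0n ?ler1n; lia.
Qed.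

(** * Slow variation of |M(x)| / x *)

(** The sum of mu chi over the multiples of p is close to M(N) / p by Turan-Kubilius and to -chi(p)
    M(N / p) by multiplicativity. Absolute values discard chi(p), which is a sign because 2 < w
    excludes p = 2; the extra N on the right pays for the multiples of p^2. *)
Lemma tmertens_dilation (R : realFieldType) (w W N : nat) (T : R) :
  (2 < w)%N -> 0 < T -> \sum_(w <= p < W | prime p) p%:R^-1 + 1 <= T ^+ 2 ->
  (2 * W * W <= N)%N ->
  \sum_(w <= p < W | prime p)
    `| `|tmertens R (N %/ p)| - `|tmertens R N| / p%:R | <= N%:R * (T + 1).
Proof.
move=> w2 T0 LT WN.
have := turan_kubilius (@normr_tmoebius_le1 R) T0 LT WN.
rewrite -/(tmertens R N) => H.
have H1 : N%:R * (\sum_(w <= p < W | prime p) p%:R ^- 2) <= N%:R :> R.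
  by rewrite -[leRHS]mulr1 ler_wpM2l // sum_inv_sqr_le // ltnW.
rewrite mulrDr mulr1; apply: le_trans (lerD H H1).
rewrite mulr_sumr -big_split /= big_nat_cond [leRHS]big_nat_cond.
apply: ler_sum => p /andP[/andP[wp _] pp].
have := sum_tmoebius_multiples R N pp.
set S := \sum_(_ <= _ < _ | _) _; move=> H2.
have p0 : 0 < p%:R :> R by rewrite ltr0n prime_gt0.
have -> : `|tmertens R (N %/ p)| = `|chi4 R p * tmertens R (N %/ p)|.
  rewrite normrM normr_chi4; case: (even_prime pp) => [p2|->]; last by rewrite mul1r.
  by move: wp; rewrite p2 leqNgt w2.
have -> : `|tmertens R N| / p%:R = `|- (tmertens R N / p%:R)|.
  by rewrite normrN normrM [X in _ = _ * X]ger0_norm // invr_ge0 ltW.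
apply: (le_trans (ler_dist_dist _ _)).
rewrite opprK.
have -> : chi4 R p * tmertens R (N %/ p) + tmertens R N / p%:R =
  (S + chi4 R p * tmertens R (N %/ p)) - (S - tmertens R N / p%:R) by ring.
apply: (le_trans (ler_normB _ _)); rewrite addrC lerD //.
Qed.

(* One step of the comparison: if the values of K at j h and at k h are both
   visible at the common point j h / p ~ k h / q, then K (j h) / (j h) and
   K (k h) / (k h) are close. *)
Lemma dilation_step (R : realFieldType) (K : nat -> R) (d : R) (p q j k h : nat) :
  (forall m n, (m <= n)%N -> `|K n - K m| <= (n - m)%:R) -> (forall n, 0 <= K n <= n%:R) ->
  0 <= d -> (0 < p)%N -> (p <= q)%N -> (p <= h)%N -> (0 < j)%N -> k = (j * q %/ p)%N ->
  `|p%:R * K (j * h %/ p)%N - K (j * h)%N| <= d * (j * h)%:R ->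
  `|q%:R * K (k * h %/ q)%N - K (k * h)%N| <= d * (k * h)%:R ->
  `|K (k * h)%N / (k * h)%:R - K (j * h)%N / (j * h)%:R| <= 2 * d + 3 / j%:R.
Proof.
move=> KL K01 d0 p0 pq ph j0 kE Hj Hk.
have q0 : (0 < q)%N by apply: leq_trans pq.
have h0 : (0 < h)%N by apply: leq_trans ph.
have jk : (j <= k)%N by rewrite kE leq_divRL // leq_mul2l pq orbT.
have k0 : (0 < k)%N by apply: leq_trans jk.
have [pR qR hR] : [/\ 0 < p%:R :> R, 0 < q%:R :> R & 0 < h%:R :> R] by rewrite !ltr0n.
have [jR kR] : 0 < j%:R :> R /\ 0 < k%:R :> R by rewrite !ltr0n.
have /andP[ku kl] := divn_itv R (j * q) p0; rewrite -kE natrM in ku kl.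
have /andP[ul uu] := divn_itv R (j * h) p0; rewrite natrM in ul uu.
have /andP[vl vu] := divn_itv R (k * h) q0; rewrite natrM in vl vu.
(* The two points differ by at most c, as k is j q / p rounded down and h / q <= c. The final 3 c =
   3 u / j collects this gap twice and a rounding error 1 <= c once. *)
pose u : R := j%:R * h%:R / p%:R; pose v : R := k%:R * h%:R / q%:R; pose c : R := h%:R / p%:R.
have c1 : 1 <= c by rewrite ler_pdivlMr // mul1r ler_nat.
have uc : u = j%:R * c by rewrite /u mulrA.
have hq : 0 < h%:R / q%:R :> R by rewrite divr_gt0.
have vE : v = k%:R * (h%:R / q%:R) by rewrite /v mulrA.
have uE : u = j%:R * q%:R / p%:R * (h%:R / q%:R).
  by rewrite /u; field; rewrite !gt_eqF.
have hqc : h%:R / q%:R <= c by rewrite ler_wpM2l ?(ltW hR) // lef_pV2 ?posrE // ler_nat.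
have uv0 : 0 <= u - v by rewrite subr_ge0 uE vE ler_wpM2r // ltW.
have uvc : u - v <= c.
  rewrite uE vE -mulrBl; apply: le_trans hqc; rewrite -[leRHS]mul1r ler_wpM2r ?(ltW hq) //; lra.
have vu' : (k * h %/ q <= j * h %/ p)%N.
  rewrite leq_divRL // -(leq_pmul2r q0) mulnAC.
  apply: (@leq_trans (k * h * p)%N); first by rewrite leq_mul2r leq_divM orbT.
  by rewrite mulnAC [leqRHS]mulnAC leq_mul2r kE leq_divM orbT.
have ab : `|K (j * h %/ p)%N - K (k * h %/ q)%N| <= u - v + 1.
  apply: (le_trans (KL _ _ vu')); rewrite natrB //; rewrite -/u in uu; rewrite -/v in vl; lra.
pose r := K (k * h)%N / (k * h)%:R; pose s := K (j * h)%N / (j * h)%:R.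
have kh0 : 0 < (k * h)%:R :> R by rewrite ltr0n muln_gt0 k0.
have jh0 : 0 < (j * h)%:R :> R by rewrite ltr0n muln_gt0 j0.
have r0 : 0 <= r by rewrite divr_ge0 //; case/andP: (K01 (k * h)%N).
have r1 : r <= 1 by rewrite ler_pdivrMr // mul1r; case/andP: (K01 (k * h)%N).
rewrite -/r -/s.
move: ab Hj Hk; move: (K (j * h %/ p)%N) (K (k * h %/ q)%N) => a b ab Hj Hk.
have {}Hj : `|a - s * u| <= d * u.
  rewrite -(ler_pM2l pR) -[X in X * _ <= _](gtr0_norm pR) -normrM.
  have -> : p%:R * (a - s * u) = p%:R * a - K (j * h)%N.
    by rewrite /s /u natrM; field; rewrite !gt_eqF.
  by rewrite (le_trans Hj) // /u natrM le_eqVlt; apply/orP; left; apply/eqP; field; rewrite gt_eqF.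
have {}Hk : `|b - r * v| <= d * v.
  rewrite -(ler_pM2l qR) -[X in X * _ <= _](gtr0_norm qR) -normrM.
  have -> : q%:R * (b - r * v) = q%:R * b - K (k * h)%N.
    by rewrite /r /v natrM; field; rewrite !gt_eqF.
  by rewrite (le_trans Hk) // /v natrM le_eqVlt; apply/orP; left; apply/eqP; field; rewrite gt_eqF.
have u0 : 0 < u by rewrite uc mulr_gt0 //; lra.
rewrite -(ler_pM2r u0).
have -> : (2 * d + 3 / j%:R) * u = 2 * d * u + 3 * c by rewrite uc; field; rewrite gt_eqF.
rewrite -[X in _ * X <= _](gtr0_norm u0) -normrM.
have H1 : 0 <= r * (u - v) by rewrite mulr_ge0.
have H2 : r * (u - v) <= u - v by rewrite ler_piMl.
have H3 : d * v <= d * u by rewrite ler_wpM2l // -subr_ge0.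
move: Hj Hk ab; rewrite !ler_norml => /andP[? ?] /andP[? ?] /andP[? ?].
by apply/andP; split; lra.
Qed.

(** The pair depends on h but serves all j < N at once, whereas sg depends on eta alone. Averaged
    over p with weight 1 / p, the total relative error [D p] is small; by Markov's inequality the p
    with [D p] > d have less than half of the mass, and [prime_blocks_spread] finds p and q among
    the others. *)
Lemma good_dilations (R : realType) (eta : R) : 0 < eta ->
  exists2 sg : R, 0 < sg & forall (d : R) (N : nat), 0 < d ->
  exists H : nat, forall h, (H <= h)%N ->
  exists p q : nat, [/\ (0 < p)%N, (p <= q)%N, (q <= h)%N,
    (1 + sg) * p%:R <= q%:R <= (1 + eta) * p%:R &
    forall r, r = p \/ r = q -> forall j, (0 < j < N)%N ->
      `|r%:R * `|tmertens R (j * h %/ r)| - `|tmertens R (j * h)| | <= d * (j * h)%:R].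
Proof.
move=> eta0; have [s [s0 _ [w w2 HB]]] := prime_blocks_spread eta0.
exists (s ^+ 2); first by rewrite exprn_gt0.
move=> d N d0; pose k : R := d / (4 * N.+1%:R).
have NR : 0 < N.+1%:R :> R by rewrite ltr0n.
have k0 : 0 < k by rewrite divr_gt0 // mulr_gt0.
have kd : k * (4 * N.+1%:R) = d by rewrite divfK // gt_eqF // mulr_gt0.
(* Enough mass L for T = k L to satisfy L + 1 <= T^2 and T >= 2; the summed error (N + 1) (T + 1)
   then stays below d L / 2. *)
have [W] := HB (1 + 2 / k + 2 / k ^+ 2).
set L := \sum_(_ <= _ < _ | _) _ => BL HW.
have k20 : 0 < k ^+ 2 by rewrite exprn_gt0.
have ik0 : 0 < 2 / k by rewrite divr_gt0.
have ik20 : 0 < 2 / k ^+ 2 by rewrite divr_gt0.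
have L1 : 1 <= L by lra.
have kL : 2 <= k * L.
  have : k * (2 / k) <= k * L by rewrite ler_pM2l //; lra.
  by rewrite mulrCA mulfV ?mulr1 // gt_eqF.
have k2L : 2 <= k ^+ 2 * L.
  have : k ^+ 2 * (2 / k ^+ 2) <= k ^+ 2 * L by rewrite ler_pM2l //; lra.
  by rewrite mulrCA mulfV ?mulr1 // gt_eqF.
have T0 : 0 < k * L by lra.
have LT : L + 1 <= (k * L) ^+ 2.
  have -> : (k * L) ^+ 2 = k ^+ 2 * L * L by ring.
  have : 2 * L <= k ^+ 2 * L * L by rewrite ler_wpM2r //; lra.
  by lra.
exists (2 * W * W + W).+1 => h hH.
pose K n : R := `|tmertens R n|.
pose D p : R := \sum_(1 <= j < N) `|p%:R * K (j * h %/ p)%N - K (j * h)%N| / (j * h)%:R.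
have Dterm p j : (0 < j < N)%N ->
    `|p%:R * K (j * h %/ p)%N - K (j * h)%N| / (j * h)%:R <= D p.
  move=> jN; rewrite /D (bigD1_seq j) ?iota_uniq ?mem_index_iota //= lerDl.
  by apply: sumr_ge0 => i _; rewrite divr_ge0.
have [|p [q [pp pq /andP[wp qW] /andP[pG qG] /andP[pq1 pq2]]]] := HW (fun p => D p <= d).
  rewrite -(ltr_pM2l d0).
  apply: (@le_lt_trans _ _ (\sum_(w <= p < W | prime p) D p / p%:R)).
    rewrite big_mkcondr mulr_sumr; apply: ler_sum => p pp.
    case: ifP => [|_]; last by rewrite mulr0 divr_ge0 // sumr_ge0 // => j _; rewrite divr_ge0.
    by rewrite -ltNge => /ltW dD; rewrite ler_wpM2r ?invr_ge0.
  apply: (@le_lt_trans _ _ (\sum_(1 <= j < N) (k * L + 1))).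
    under eq_bigr do rewrite mulr_suml.
    rewrite exchange_big /= big_nat [leRHS]big_nat; apply: ler_sum => j /andP[j0 jN].
    have WN : (2 * W * W <= j * h)%N.
      apply: (@leq_trans h); last by rewrite leq_pmull.
      by apply: leq_trans hH; rewrite leqW // leq_addr.
    have jh0 : 0 < (j * h)%:R :> R by rewrite ltr0n muln_gt0 j0; case: (h) hH.
    have jh' : 0 <= (j * h)%:R^-1 :> R by rewrite invr_ge0 ltW.
    have := ler_wpM2l jh' (tmertens_dilation w2 T0 LT WN).
    rewrite mulKf ?gt_eqF //.
    apply: le_trans; rewrite mulr_sumr big_nat_cond [leRHS]big_nat_cond.
    rewrite le_eqVlt; apply/orP; left; apply/eqP; apply: eq_bigr => p /andP[/andP[wp _] pp].
    have p0 : 0 < p%:R :> R by rewrite ltr0n prime_gt0.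
    rewrite mulrAC mulrC; congr (_ * _).
    rewrite -[X in _ * X](gtr0_norm (_ : 0 < p%:R^-1)) ?invr_gt0 // -normrM; congr `|_|.
    by rewrite /K; field; rewrite gt_eqF.
  rewrite sumr_const_nat -[ltLHS]mulr_natl.
  apply: (@le_lt_trans _ _ (N.+1%:R * (k * L + 1))).
    by rewrite ler_wpM2r //; [lra | rewrite ler_nat subn1 (leq_trans (leq_pred _))].
  rewrite -kd; have : N.+1%:R * (k * L + 1) < N.+1%:R * (2 * (k * L)) by rewrite ltr_pM2l //; lra.
  by lra.
have pq' : (p <= q)%N.
  rewrite -(ler_nat R); apply: le_trans pq1; rewrite ler_peMl //.
  by have := sqr_ge0 s; lra.
exists p, q; split=> //; first by rewrite prime_gt0.
- by apply: leq_trans hH; apply: ltnW; rewrite ltnS; apply: leq_trans (ltnW qW) _; rewrite leq_addl.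
- by rewrite pq1.
- move=> r rpq j jN.
  have jh0 : 0 < (j * h)%:R :> R.
    by case/andP: jN => j0 _; rewrite ltr0n muln_gt0 j0; case: (h) hH.
  rewrite -ler_pdivrMr //; apply: (le_trans (Dterm r j jN)).
  by case: rpq => ->.
Qed.

Lemma tmertens_ratio_lip (R : realFieldType) (m n : nat) : (0 < m)%N -> (m <= n)%N ->
  `| `|tmertens R n| / n%:R - `|tmertens R m| / m%:R | <= 2 * (n%:R / m%:R - 1).
Proof.
move=> m0 mn; have n0 : (0 < n)%N by apply: leq_trans mn.
have mR : 0 < m%:R :> R by rewrite ltr0n.
have nR : 0 < n%:R :> R by rewrite ltr0n.
have mnR : m%:R <= n%:R :> R by rewrite ler_nat.
have H : `| `|tmertens R n| - `|tmertens R m| | <= n%:R - m%:R.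
  by apply: le_trans (ler_dist_dist _ _) _; rewrite -natrB // tmertens_dist.
have M1 := normr_tmertens_le R m; have M0 := normr_ge0 (tmertens R m).
move: M1 M0 H; move: (`|tmertens R n|) (`|tmertens R m|) => a b b1 b0 H.
rewrite -(ler_pM2r nR) -[X in _ * X <= _](gtr0_norm nR) -normrM.
have -> : (a / n%:R - b / m%:R) * n%:R = (a - b) + b * (m%:R - n%:R) / m%:R.
  by field; rewrite !gt_eqF.
apply: (le_trans (ler_normD _ _)).
have H2 : `|b * (m%:R - n%:R) / m%:R| <= n%:R - m%:R.
  rewrite normrM [X in _ * X]ger0_norm ?invr_ge0 ?ler0n // ler_pdivrMr //.
  rewrite normrM (ger0_norm b0) ler0_norm ?subr_le0 // opprB mulrC.
  by rewrite ler_wpM2l // subr_ge0.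
apply: (@le_trans _ _ (2 * (n%:R - m%:R))); first by lra.
have -> : 2 * (n%:R / m%:R - 1) * n%:R = 2 * (n%:R - m%:R) * (n%:R / m%:R) :> R.
  by field; rewrite gt_eqF.
rewrite ler_peMr ?mulr_ge0 ?subr_ge0 //.
by rewrite ler_pdivlMr // mul1r.
Qed.

(* The map j -> floor (j q / p) leads from J to any j <= 2 A J in at most S steps,
   where S does not depend on J; only then are J and the precision d chosen. *)
Lemma tmertens_slow (R : realType) (eps : R) (A : nat) : 0 < eps ->
  exists X0 : nat, forall x y, (X0 <= x)%N -> (x <= y <= A * x)%N ->
  `| `|tmertens R y| / y%:R - `|tmertens R x| / x%:R | <= eps.
Proof.
move=> eps0; pose eta := eps / 16.
have eta0 : 0 < eta by rewrite divr_gt0.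
have [sg sg0 HD] := good_dilations eta0.
(* Each step raises j by at least sg / 2 * J, the other half of the gain being left to rounding
   thanks to 2 <= sg * J below. So at most S steps stay within 2 A J. *)
pose S : R := 2 * (2 * A)%:R / sg.
have S0 : 0 <= S by rewrite divr_ge0 ?mulr_ge0 // ltW.
have [J J0 [Jsg JS]] : exists2 J : nat, (0 < J)%N & 2 / sg <= J%:R /\ (24 * S + 16) / eps <= J%:R.
  exists (maxn (Num.truncn (2 / sg)) (Num.truncn ((24 * S + 16) / eps))).+1 => //.
  by split; apply: le_trans (ltW (truncnS_gt _)) _; rewrite ler_nat ltnS ?leq_maxl ?leq_maxr.
have JR : 0 < J%:R :> R by rewrite ltr0n.
have {}Jsg : 2 <= sg * J%:R by move: Jsg; rewrite ler_pdivrMr // mulrC.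
have {}JS : 3 * S / J%:R + 2 / J%:R <= eps / 8.
  by move: JS; rewrite ler_pdivrMr // -mulrDl ler_pdivrMr // => H; lra.
pose d := eps / (16 * (S + 1)).
have d0 : 0 < d by rewrite divr_gt0 // mulr_gt0 //; lra.
have dS : S * (2 * d) <= eps / 8.
  have : d * (16 * (S + 1)) = eps by rewrite divfK // gt_eqF // mulr_gt0 //; lra.
  by lra.
have [H HH] := HD d (2 * A * J).+1 d0.
have [h0 h00 heps] : exists2 h0 : nat, (0 < h0)%N & 16 / eps <= h0%:R.
  by exists (Num.truncn (16 / eps)).+1 => //; apply/ltW/truncnS_gt.
exists (J * (H + h0))%N => x y xX /andP[xy yA].
pose h := (x %/ J)%N.
have hHh : (H + h0 <= h)%N by rewrite leq_divRL // mulnC.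
have hH : (H <= h)%N by apply: leq_trans hHh; apply: leq_addr.
have hh0 : (h0 <= h)%N by apply: leq_trans hHh; apply: leq_addl.
have h1 : (0 < h)%N by apply: leq_trans hh0.
have hR : 0 < h%:R :> R by rewrite ltr0n.
have heps' : 2 / h%:R <= eps / 8.
  rewrite ler_pdivrMr //; have : h0%:R <= h%:R :> R by rewrite ler_nat.
  rewrite -(ler_pM2r eps0) => H1; move: heps; rewrite ler_pdivrMr // => H2; lra.
have [p [q [p0 pq qh /andP[pq1 pq2] good]]] := HH h hH.
have q0 : (0 < q)%N by apply: leq_trans pq.
have pR : 0 < p%:R :> R by rewrite ltr0n.
pose rho n : R := `|tmertens R n| / n%:R; rewrite -/(rho x) -/(rho y).
pose js i := iter i (fun j => (j * q %/ p)%N) J.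
have step j : (J <= j)%N ->
   (1 + sg / 2) * j%:R <= (j * q %/ p)%:R <= (1 + eta) * j%:R.
  move=> Jj; have jR : J%:R <= j%:R :> R by rewrite ler_nat.
  have /andP[l u] := divn_itv R (j * q) p0; rewrite natrM in l u.
  have l1 : (1 + sg) * j%:R <= j%:R * q%:R / p%:R.
    by rewrite ler_pdivlMr // mulrAC mulrC ler_wpM2l.
  have u1 : j%:R * q%:R / p%:R <= (1 + eta) * j%:R.
    by rewrite ler_pdivrMr // mulrAC mulrC ler_wpM2r.
  have : sg * J%:R <= sg * j%:R by rewrite ler_pM2l.
  by move=> ?; apply/andP; split; lra.
have jsJ i : (J <= js i)%N.
  elim: i => //= i IH; apply: (leq_trans IH).
  have /andP[l _] := step _ IH; rewrite -(ler_nat R); apply: le_trans l.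
  by rewrite ler_peMl //; lra.
have jsgrow i : (1 + i%:R * (sg / 2)) * J%:R <= (js i)%:R.
  elim: i => [|i IH]; first by rewrite mul0r addr0 mul1r.
  have /andP[l _] := step _ (jsJ i); apply: le_trans l.
  have : sg / 2 * J%:R <= sg / 2 * (js i)%:R by rewrite ler_pM2l ?ler_nat ?divr_gt0.
  by rewrite -[i.+1%:R]natr1; lra.
have chain i : (js i <= 2 * A * J)%N ->
    `|rho (js i * h)%N - rho (J * h)%N| <= i%:R * (2 * d + 3 / J%:R).
  elim: i => [|i IH] jsi; first by rewrite subrr normr0 mul0r.
  have js1 : (js i <= js i.+1)%N by rewrite /= leq_divRL // leq_mul2l pq orbT.
  have j0 : (0 < js i)%N by apply: leq_trans (jsJ i).
  have js2 : (js i <= 2 * A * J)%N by apply: leq_trans js1 jsi.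
  have G1 := good p (or_introl erefl) (js i).
  have G2 := good q (or_intror erefl) (js i.+1).
  rewrite j0 ltnS js2 in G1; rewrite ltnS jsi (leq_trans j0 js1) in G2.
  pose K n : R := `|tmertens R n|.
  have KL m n : (m <= n)%N -> `|K n - K m| <= (n - m)%:R.
    by move=> mn; apply: le_trans (ler_dist_dist _ _) _; apply: tmertens_dist.
  have K01 n : 0 <= K n <= n%:R by rewrite normr_ge0 normr_tmertens_le.
  have HS : `|rho (js i.+1 * h)%N - rho (js i * h)%N| <= 2 * d + 3 / (js i)%:R.
    exact: (@dilation_step R K d p q (js i) (js i.+1) h KL K01 (ltW d0) p0 pq
      (leq_trans pq qh) j0 erefl (G1 isT) (G2 isT)).
  have J3 : 3 / (js i)%:R <= 3 / J%:R :> R.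
    by rewrite ler_pM2l // lef_pV2 ?posrE ?ltr0n // ler_nat.
  have := IH js2; rewrite -[i.+1%:R]natr1 => H1.
  have -> : rho (js i.+1 * h)%N - rho (J * h)%N =
    (rho (js i * h)%N - rho (J * h)%N) + (rho (js i.+1 * h)%N - rho (js i * h)%N) by ring.
  by apply: (le_trans (ler_normD _ _)); lra.
pose j := (y %/ h)%N.
have Jj : (J <= j)%N.
  by rewrite leq_divRL // (leq_trans _ xy) // mulnC leq_divM.
have j0 : (0 < j)%N by apply: leq_trans Jj.
have xh : (x < h.+1 * J)%N by apply: ltn_ceil.
have jA : (j <= 2 * A * J)%N.
  rewrite -ltnS ltn_divLR //; apply: (leq_ltn_trans yA).
  have : (A * x <= A * (h.+1 * J))%N by rewrite leq_mul2l (ltnW xh) orbT.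
  by move: h1 J0; clear; nia.
have [n nj] : exists n, (j < js n)%N.
  exists (Num.truncn (2 * j%:R / sg)).+1; rewrite -(ltr_nat R).
  apply: lt_le_trans (jsgrow _).
  have := truncnS_gt (2 * j%:R / sg); rewrite ltr_pdivrMr // => H1.
  move: (Num.truncn (2 * j%:R / sg)).+1 H1 => n H1; have n0 : 0 <= n%:R * (sg / 2) by rewrite mulr_ge0 ?divr_ge0 // ltW.
  apply: (@lt_le_trans _ _ (1 + n%:R * (sg / 2))); first by lra.
  by rewrite ler_peMr ?ler1n //; lra.
(* Stops the iteration just before it passes j: then j lies between [js i] and (1 + eta) times
   [js i]. *)
have [[|i] /= nj' nmin] := ex_minnP (ex_intro (fun n => (j < js n)%N) n nj).
  by move: nj'; rewrite ltnNge Jj.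
have ij : (js i <= j)%N by rewrite leqNgt; apply/negP => /nmin; rewrite ltnn.
have ji0 : (0 < js i)%N by apply: leq_trans (jsJ i).
have jiR : 0 < (js i)%:R :> R by rewrite ltr0n.
have jR : 0 < j%:R :> R by rewrite ltr0n.
have iS : i%:R <= S.
  rewrite /S ler_pdivlMr //.
  have : (1 + i%:R * (sg / 2)) * J%:R <= (2 * A)%:R * J%:R.
    by apply: (le_trans (jsgrow i)); rewrite -natrM ler_nat (leq_trans ij).
  by rewrite ler_pM2r //; lra.
have E1 : `|rho y - rho (j * h)%N| <= 2 / J%:R.
  apply: le_trans (tmertens_ratio_lip R _ (leq_divM y h)) _; first by rewrite muln_gt0 j0.
  rewrite ler_pM2l //; apply: (@le_trans _ _ j%:R^-1); last first.
    by rewrite lef_pV2 ?posrE // ler_nat.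
  rewrite lerBlDr ler_pdivrMr ?ltr0n ?muln_gt0 ?j0 //.
  have -> : (j%:R^-1 + 1) * (j * h)%:R = (j.+1 * h)%:R :> R.
    by rewrite !natrM -[j.+1%:R]natr1; field; rewrite gt_eqF.
  by rewrite ler_nat ltnW // ltn_ceil.
have E2 : `|rho (j * h)%N - rho (js i * h)%N| <= 2 * eta.
  apply: le_trans (tmertens_ratio_lip R _ _) _; rewrite ?muln_gt0 ?ji0 //.
    by rewrite leq_mul2r ij orbT.
  rewrite ler_pM2l // lerBlDr ler_pdivrMr ?ltr0n ?muln_gt0 ?ji0 //.
  rewrite !natrM mulrA ler_pM2r // addrC.
  have /andP[_] := step _ (jsJ i); apply: le_trans.
  by rewrite ler_nat ltnW.
have E3 := chain i (leq_trans ij jA).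
have E3' : i%:R * (2 * d + 3 / J%:R) <= S * (2 * d + 3 / J%:R).
  by rewrite ler_wpM2r // addr_ge0 ?divr_ge0 // mulr_ge0 // ltW.
have E4 : `|rho x - rho (J * h)%N| <= 2 / h%:R.
  have Jhx : (J * h <= x)%N by rewrite mulnC leq_divM.
  apply: le_trans (tmertens_ratio_lip R _ Jhx) _; first by rewrite muln_gt0 J0.
  rewrite ler_pM2l // lerBlDr ler_pdivrMr ?ltr0n ?muln_gt0 ?J0 //.
  have -> : (h%:R^-1 + 1) * (J * h)%:R = (h.+1 * J)%:R :> R.
    by rewrite !natrM -[h.+1%:R]natr1; field; rewrite gt_eqF.
  by rewrite ler_nat ltnW.
(* From y to the grid point j h, to the nearest iterate below, back along the chain to J h, and to
   x; the grid has mesh h = x / J. *)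
have -> : rho y - rho x = (rho y - rho (j * h)%N) + (rho (j * h)%N - rho (js i * h)%N)
  + (rho (js i * h)%N - rho (J * h)%N) - (rho x - rho (J * h)%N) by ring.
apply: le_trans (ler_normB _ _) _; apply: le_trans (lerD (ler_normD _ _) E4) _.
apply: le_trans (lerD (lerD (ler_normD _ _) (le_trans E3 E3')) heps') _.
by move: E2; rewrite /eta => E2; lra.
Qed.

(** * Cancellation in M and over the primes *)

Lemma tmertens_littleo (R : realType) (eps : R) : 0 < eps ->
  exists N0 : nat, forall N, (N0 <= N)%N -> `|tmertens R N| <= eps * N%:R.
Proof.
move=> eps0.
(* Chosen to contradict (eps / 2) ln a <= 10, where 10 = 2 * 5 bounds the variation of [V] below. *)
have [a a0 aE] : exists2 a : nat, (0 < a)%N & 20 / eps < ln a%:R.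
  exists (Num.truncn (expR (20 / eps))).+1 => //.
  by rewrite -[ltLHS]expRK ltr_ln ?posrE ?expR_gt0 ?ltr0n // truncnS_gt.
have e20 : 0 < eps / 2 by rewrite divr_gt0.
have [X0 HX] := tmertens_slow (2 * a) e20.
have [x1 x10 x1E] : exists2 x1 : nat, (0 < x1)%N & 4 / eps <= x1%:R.
  by exists (Num.truncn (4 / eps)).+1 => //; apply/ltW/truncnS_gt.
exists (X0 + x1)%N => x xX; rewrite leNgt; apply/negP => Mx.
have xX0 : (X0 <= x)%N by apply: leq_trans xX; apply: leq_addr.
have xx1 : (x1 <= x)%N by apply: leq_trans xX; apply: leq_addl.
have x0 : (0 < x)%N by apply: leq_trans xx1.
have xR : 0 < x%:R :> R by rewrite ltr0n.
have epsx : 4 <= eps * x%:R.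
  have : x1%:R <= x%:R :> R by rewrite ler_nat.
  by rewrite -(ler_pM2l eps0) => H1; move: x1E; rewrite ler_pdivrMr // => H2; lra.
pose s := Num.sg (tmertens R x).
have Mx0 : tmertens R x != 0.
  by apply: contraTneq Mx => ->; rewrite normr0 -leNgt mulr_ge0 // ltW.
have s1 : `|s| = 1 by rewrite normr_sg Mx0.
have absM y : (x <= y <= 2 * a * x)%N -> eps / 2 * y%:R <= `|tmertens R y|.
  move=> /andP[xy ya]; have y0 : 0 < y%:R :> R by rewrite ltr0n; apply: leq_trans xy.
  have := HX x y xX0; rewrite xy ya => /(_ isT); rewrite ler_norml => /andP[H _].
  rewrite -ler_pdivlMr //; apply: (@le_trans _ _ (`|tmertens R x| / x%:R - eps / 2)).
    by have : eps < `|tmertens R x| / x%:R; [rewrite ltr_pdivlMr | lra].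
  by lra.
have xa : (x <= 2 * a * x)%N by rewrite leq_pmull // muln_gt0.
(* M keeps the sign s: by [absM] and 4 <= eps * x its size is at least 2, and consecutive values
   differ by at most 1. *)
have sM k : (x + k <= 2 * a * x)%N -> eps / 2 * (x + k)%:R <= s * tmertens R (x + k).
  elim: k => [|k IH] xk.
    by rewrite addn0 -normrEsg; apply: absM; rewrite leqnn xa.
  have {}IH := IH (leq_trans (leq_add (leqnn x) (leqnSn k)) xk).
  have step : s * tmertens R (x + k) - s * tmertens R (x + k.+1) <= 1.
    rewrite -mulrBr; apply: le_trans (ler_norm _) _; rewrite normrM s1 mul1r distrC.
    by apply: (le_trans (tmertens_dist _ _)); rewrite ?leq_add2l // subnDl subSnn.
  have pos : 0 <= s * tmertens R (x + k.+1).
    have : eps / 2 * x%:R <= eps / 2 * (x + k)%:R by rewrite ler_pM2l // ler_nat leq_addr.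
    by lra.
  by rewrite -(ger0_norm pos) normrM s1 mul1r; apply: absM; rewrite leq_addr.
(* Partial summation of mu(n) chi(n) / n: the increments of [V] are M(n) / (n (n + 1)), while |V| <=
   4 + 1. *)
pose V n : R := \sum_(1 <= i < n) tmoebius R i / i%:R - tmertens R n.-1 / n%:R.
have VD n : (0 < n)%N -> V n.+1 - V n = tmertens R n * (n%:R^-1 - n.+1%:R^-1).
  move=> n0; rewrite /V big_nat_recr //=.
  have -> : tmertens R n = tmertens R n.-1 + tmoebius R n.
    by rewrite /tmertens -{1}(prednK n0) big_nat_recr ?prednK.
  have : 0 < n%:R :> R by rewrite ltr0n.
  have : 0 < n.+1%:R :> R by rewrite ltr0n.
  move: (n%:R : R) (n.+1%:R : R) => u v v0 u0; field.
  by rewrite !gt_eqF.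
have Vb n : (0 < n)%N -> `|V n| <= 5.
  move=> n0; apply: (le_trans (ler_normB _ _)).
  have -> : 5 = 4 + 1 :> R by lra.
  rewrite lerD //; first by rewrite -(prednK n0) sum_tmoebius_inv_bound.
  rewrite normrM [X in _ * X]ger0_norm ?invr_ge0 // ler_pdivrMr ?ltr0n // mul1r.
  by apply: (le_trans (normr_tmertens_le _ _)); rewrite ler_nat leq_pred.
have : s * (V (2 * a * x)%N - V x) <= 10.
  apply: le_trans (ler_norm _) _; rewrite normrM s1 mul1r.
  apply: le_trans (ler_normB _ _) _; have -> : 10 = 5 + 5 :> R by lra.
  by rewrite lerD // Vb // muln_gt0 muln_gt0 a0.
rewrite -(telescope_sumr V xa) mulr_sumr => H10.
have : \sum_(x <= k < 2 * a * x) eps / 2 * k.+1%:R^-1 <= 10.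
  apply: le_trans H10; rewrite big_nat [leRHS]big_nat; apply: ler_sum => k /andP[xk ka].
  have k0 : (0 < k)%N by apply: leq_trans xk.
  have kR : 0 < k%:R :> R by rewrite ltr0n.
  have k1R : 0 < k.+1%:R :> R by rewrite ltr0n.
  have := sM (k - x)%N; rewrite subnKC // => /(_ (ltnW ka)) H.
  have D : k%:R^-1 - k.+1%:R^-1 = k%:R^-1 * k.+1%:R^-1 :> R.
    by move: k1R; rewrite -[k.+1%:R]natr1 => k1R; field; rewrite !gt_eqF.
  rewrite VD // D mulrA [leRHS]mulrA ler_pM2r ?invr_gt0 // ler_pdivlMr //.
rewrite -mulr_sumr => H.
have H1 := le_trans (ler_wpM2l (ltW e20) (harmonic_ge R xa)) H.
have H2 : ln a%:R <= ln (2 * a * x).+1%:R - ln x.+1%:R :> R.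
  rewrite lerBrDr -lnM ?posrE ?ltr0n // -natrM ler_lnn ?muln_gt0 ?a0 //.
  by move: a0 x0; clear; nia.
have H3 := le_trans (ler_wpM2l (ltW e20) H2) H1.
by move: aE; rewrite ltr_pdivrMr // => H4; lra.
Qed.

(** Small compared with N when B / N is small, which disposes of the small indices in two later
    splittings; there B = N / m^2. *)
Lemma sum_ln_ratio_le (R : realType) (N B : nat) : (B <= N)%N ->
  \sum_(1 <= a < B.+1) ln (N%:R / a%:R) <= 4 * Num.sqrt (N * B)%:R :> R.
Proof.
move=> BN; have : \sum_(1 <= a < B.+1) (Num.sqrt a%:R)^-1 <= 2 * Num.sqrt B%:R :> R.
  elim: B {BN} => [|B IH]; first by rewrite big_geq // sqrtr0 mulr0.
  rewrite big_nat_recr //=; apply: (le_trans (lerD IH (lexx _))).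
  have b0 : 0 < Num.sqrt B.+1%:R :> R by rewrite sqrtr_gt0 ltr0n.
  have a0 : 0 <= Num.sqrt B%:R :> R by apply: sqrtr_ge0.
  have : Num.sqrt B.+1%:R ^+ 2 = 1 + Num.sqrt B%:R ^+ 2 :> R.
    by rewrite !sqr_sqrtr // nat1r.
  move: (Num.sqrt B.+1%:R : R) (Num.sqrt B%:R : R) b0 a0 => b a b0 a0 ab.
  rewrite -(ler_pM2r b0) mulrDl mulVf ?gt_eqF //.
  have : 0 <= (b - a) ^+ 2 by apply: sqr_ge0.
  by rewrite !expr2 in ab *; lra.
move=> H; rewrite natrM sqrtrM ?ler0n //.
apply: (@le_trans _ _ (\sum_(1 <= a < B.+1) 2 * Num.sqrt N%:R * (Num.sqrt a%:R)^-1)).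
  rewrite big_nat [leRHS]big_nat; apply: ler_sum => a /andP[a0 aB].
  have aR : 0 < a%:R :> R by rewrite ltr0n.
  have NR : 0 < N%:R :> R by rewrite ltr0n; apply: leq_trans a0 _; apply: leq_trans BN.
  apply: (le_trans (ln_le_2sqrt (divr_gt0 NR aR))).
  by rewrite sqrtrM ?ler0n // sqrtrV ?ler0n // mulrA.
rewrite -mulr_sumr; have S0 : 0 <= 2 * Num.sqrt N%:R :> R by rewrite mulr_ge0 ?sqrtr_ge0.
by apply: (le_trans (ler_wpM2l S0 H)); lra.
Qed.

Lemma sqrt_divn_sqr_le (R : rcfType) (N m : nat) : (0 < m)%N ->
  Num.sqrt (N * (N %/ (m * m)))%:R <= N%:R / m%:R :> R.
Proof.
move=> m0; have mR : 0 < m%:R :> R by rewrite ltr0n.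
have H : 0 <= N%:R / m%:R :> R by rewrite divr_ge0.
rewrite -(ger0_norm H) -sqrtr_sqr ler_sqrt ?sqr_ge0 // expr_div_n.
rewrite ler_pdivlMr ?exprn_gt0 // -!natrX -natrM ler_nat -!mulnn -mulnA leq_mul2l.
by rewrite leq_divM orbT.
Qed.

Lemma sum_pow_dvdn (R : pzSemiRingType) (p b N : nat) : prime p -> (0 < b <= N)%N ->
  \sum_(1 <= k < N.+1) (p ^ k %| b)%:R = (logn p b)%:R :> R.
Proof.
move=> pp /andP[b0 bN]; rewrite logn_count_dvd // natr_sum.
rewrite (@big_cat_nat _ _ _ b) //=; last by rewrite ltnW.
rewrite [X in _ + X]big1_seq ?addr0 // => k /andP[_]; rewrite mem_index_iota => /andP[bk _].
rewrite gtnNdvd //; apply: leq_ltn_trans bk _; apply: ltn_expl; exact: prime_gt1.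
Qed.

(* Both sides are the sum of chi Lambda up to N, Lambda being von Mangoldt's
   function. *)
Lemma sum_tmoebius_chi4_ln (R : realType) (N : nat) :
  \sum_(1 <= a < N.+1) tmoebius R a * \sum_(1 <= b < (N %/ a).+1) chi4 R b * ln b%:R =
  \sum_(1 <= p < N.+1 | prime p) \sum_(1 <= k < N.+1 | (p ^ k <= N)%N)
    chi4 R (p ^ k) * ln p%:R.
Proof.
pose C y : R := \sum_(1 <= c < y.+1) chi4 R c.
have TE y : (y <= N)%N -> \sum_(1 <= b < y.+1) chi4 R b * ln b%:R =
    \sum_(1 <= p < N.+1 | prime p) \sum_(1 <= k < N.+1)
       (chi4 R (p ^ k) * ln p%:R) * C (y %/ p ^ k)%N.
  move=> yN.
  transitivity (\sum_(1 <= b < y.+1) \sum_(1 <= p < N.+1 | prime p) \sum_(1 <= k < N.+1)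
      ln p%:R * (chi4 R b * (p ^ k %| b)%:R)).
    apply: eq_big_nat => b /andP[b0 by'].
    have bN : (b <= N)%N by apply: leq_trans yN.
    rewrite (@ln_logn R b N) //; last by move=> p _ /(dvdn_leq b0)/leq_trans; apply.
    rewrite mulr_sumr; apply: eq_bigr => p pp.
    by rewrite -mulr_sumr -mulr_sumr sum_pow_dvdn ?b0 //; ring.
  rewrite exchange_big /=; apply: eq_bigr => p pp.
  rewrite exchange_big /=; apply: eq_bigr => k _.
  have pk0 : (0 < p ^ k)%N by rewrite expn_gt0 prime_gt0.
  rewrite -mulr_sumr [_ * ln _]mulrC -mulrA; congr (_ * _).
  rewrite /C mulr_sumr; under [RHS]eq_bigr do rewrite -chi4M.
  rewrite -(sum_multiples y (chi4 R)) // [RHS]big_mkcond /=.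
  by apply: eq_bigr => b _; case: ifP => _; rewrite ?mulr1 ?mulr0.
transitivity (\sum_(1 <= a < N.+1) \sum_(1 <= p < N.+1 | prime p) \sum_(1 <= k < N.+1)
   chi4 R (p ^ k) * ln p%:R * (tmoebius R a * C (N %/ a %/ p ^ k)%N)).
  apply: eq_bigr => a _; rewrite TE ?leq_div // mulr_sumr.
  by apply: eq_bigr => p _; rewrite mulr_sumr; apply: eq_bigr => k _; rewrite mulrCA.
rewrite exchange_big /=; apply: eq_bigr => p pp.
rewrite exchange_big /= [RHS]big_mkcond /=; apply: eq_bigr => k _.
have pk0 : (0 < p ^ k)%N by rewrite expn_gt0 prime_gt0.
(* The sum over a convolves mu chi with the summatory function of chi: it is 1 if p^k <= N and
   vanishes otherwise. *)
rewrite -mulr_sumr.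
have -> : \sum_(1 <= a < N.+1) tmoebius R a * C (N %/ a %/ p ^ k)%N =
   \sum_(1 <= a < (N %/ p ^ k).+1) tmoebius R a * C (N %/ p ^ k %/ a)%N.
  rewrite (@big_cat_nat _ _ _ (N %/ p ^ k).+1) //=; last by rewrite ltnS leq_div.
  rewrite [X in _ + X]big1_seq ?addr0 => [|a /andP[_]].
    by apply: eq_bigr => a _; rewrite -!divnMA mulnC.
  rewrite mem_index_iota => /andP[aN _]; rewrite -divnMA mulnC divnMA divn_small //.
  by rewrite /C big_geq // mulr0.
case: leqP => [pN|Np]; last by rewrite divn_small // big_geq // mulr0.
rewrite (sum_moebius_conv (chi4M R)); last by rewrite divn_gt0.
by rewrite chi4_1 mulr1.
Qed.

(** Hyperbola method. For a <= N / K the inner sum is at most ln (N / a), by alternation. For larger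
    a only b <= K occur, and exchanging the sums produces increments of M between points from N / K
    on, where M(x) = o(x) applies. *)
Lemma sum_tmoebius_chi4_ln_littleo (R : realType) (eps : R) : 0 < eps ->
  exists N0 : nat, forall N, (N0 <= N)%N ->
  `|\sum_(1 <= a < N.+1) tmoebius R a * \sum_(1 <= b < (N %/ a).+1) chi4 R b * ln b%:R|
  <= eps * N%:R.
Proof.
move=> eps0.
have [m m0 mE] : exists2 m : nat, (0 < m)%N & 8 / eps <= m%:R.
  by exists (Num.truncn (8 / eps)).+1 => //; apply/ltW/truncnS_gt.
pose K := (m * m)%N.
have K0 : (0 < K)%N by rewrite muln_gt0 m0.
have KR : 0 < K%:R :> R by rewrite ltr0n.
(* Gives K (1 + ln K) * 2 d = eps / 2; the added 1 keeps the denominator positive when K = 1. *)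
pose d := eps / (4 * (K%:R * (1 + ln K%:R))).
have lK : 0 <= ln K%:R :> R by apply: lnn_ge0.
have d0 : 0 < d by rewrite divr_gt0 // !mulr_gt0 //; lra.
have dE : d * (4 * (K%:R * (1 + ln K%:R))) = eps.
  by rewrite divfK // gt_eqF // !mulr_gt0 //; lra.
have [H HM] := tmertens_littleo d0.
exists (H * K + K)%N => N HN.
have NK : (K <= N)%N by apply: leq_trans HN; apply: leq_addl.
pose B := (N %/ K)%N.
have BN : (B <= N)%N by apply: leq_div.
have N0 : 0 <= N%:R :> R by [].
pose T y : R := \sum_(1 <= b < y.+1) chi4 R b * ln b%:R.
rewrite (@big_cat_nat _ _ _ B.+1) //=.
apply: (le_trans (ler_normD _ _)).
have -> : eps * N%:R = eps / 2 * N%:R + eps / 2 * N%:R by lra.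
apply: lerD.
  apply: (le_trans (ler_norm_sum _ _ _)).
  apply: (@le_trans _ _ (\sum_(1 <= a < B.+1) ln (N%:R / a%:R))).
    rewrite big_nat [leRHS]big_nat; apply: ler_sum => a /andP[a0 aB].
    have Na : (0 < N %/ a)%N by rewrite divn_gt0 // (leq_trans _ BN).
    rewrite normrM; apply: (@le_trans _ _ (1 * `|T (N %/ a)%N|)).
      by rewrite ler_wpM2r // normr_tmoebius_le1.
    rewrite mul1r; apply: (@le_trans _ _ (ln (N %/ a)%:R)).
      apply: (chi4_incr_sum (g := fun n => ln n%:R)) => // n n0.
      by rewrite lnn_ge0 ler_lnn.
    rewrite ler_ln ?posrE ?ltr0n // ?divr_gt0 ?ltr0n //; last exact: leq_trans NK.
    by have /andP[] := divn_itv R N a0.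
  apply: (le_trans (sum_ln_ratio_le R BN)).
  apply: (@le_trans _ _ (4 * (N%:R / m%:R))).
    by rewrite ler_pM2l // sqrt_divn_sqr_le.
  have : m%:R^-1 <= eps / 8 by rewrite -[leRHS]invrK lef_pV2 ?posrE ?invr_gt0 ?divr_gt0 ?ltr0n // invf_div.
  by move=> /(ler_wpM2l N0); lra.
have -> : \sum_(B.+1 <= a < N.+1) tmoebius R a * \sum_(1 <= b < (N %/ a).+1) chi4 R b * ln b%:R =
   \sum_(1 <= b < K.+1) chi4 R b * ln b%:R * (tmertens R (N %/ b) - tmertens R B).
  transitivity (\sum_(B.+1 <= a < N.+1) \sum_(1 <= b < K.+1)
      (if (a <= N %/ b)%N then chi4 R b * ln b%:R * tmoebius R a else 0)).
    apply: eq_big_nat => a /andP[Ba aN].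
    have a0 : (0 < a)%N by apply: leq_ltn_trans Ba.
    have NaK : (N %/ a <= K)%N.
      rewrite -ltnS ltn_divLR //; apply: (leq_trans (ltn_ceil N K0)).
      by rewrite mulnC leq_mul.
    rewrite mulr_sumr [RHS](@big_cat_nat _ _ _ (N %/ a).+1) //=.
    rewrite [X in _ + X]big1_seq ?addr0 => [|b /andP[_]].
      apply: eq_big_nat => b /andP[b0]; rewrite ltnS leq_divRL // => bN.
      by rewrite leq_divRL // mulnC bN mulrC.
    rewrite mem_index_iota => /andP[]; rewrite ltn_divLR // => bN _.
    rewrite ifF //; apply/negbTE; rewrite -ltnNge ltn_divLR 1?mulnC //.
    by case: b bN.
  rewrite exchange_big /=; apply: eq_big_nat => b /andP[b0 bK].
  have BNb : (B <= N %/ b)%N by apply: leq_div2l.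
  rewrite -big_mkcond -mulr_sumr; congr (_ * _).
  rewrite /tmertens [X in X - _](@big_cat_nat _ _ _ B.+1) //= addrAC subrr add0r.
  rewrite [RHS](big_nat_widen _ _ N.+1) ?ltnS ?leq_div //.
apply: (le_trans (ler_norm_sum _ _ _)).
apply: (@le_trans _ _ (\sum_(1 <= b < K.+1) (1 + ln K%:R) * (2 * d * N%:R))).
  rewrite big_nat [leRHS]big_nat; apply: ler_sum => b /andP[b0 bK].
  rewrite normrM; apply: ler_pM => //.
    rewrite normrM normr_chi4 [X in _ * X]ger0_norm ?lnn_ge0 //.
    have : ln b%:R <= ln K%:R :> R by apply: ler_lnn.
    have : 0 <= ln b%:R :> R by apply: lnn_ge0.
    by case: (odd b); rewrite ?mul1r ?mul0r; lra.
  have HB y : (B <= y)%N -> (y <= N)%N -> `|tmertens R y| <= d * N%:R.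
    move=> By yN; apply: (le_trans (HM y _)).
      apply: leq_trans By; rewrite leq_divRL //; apply: leq_trans HN; apply: leq_addr.
    by rewrite ler_pM2l // ler_nat.
  apply: (le_trans (ler_normB _ _)).
  have -> : 2 * d * N%:R = d * N%:R + d * N%:R by lra.
  by rewrite lerD // HB ?leq_div // leq_div2l.
rewrite sumr_const_nat subn1 /= -[leLHS]mulr_natl.
have -> : K%:R * ((1 + ln K%:R) * (2 * d * N%:R)) = d * (4 * (K%:R * (1 + ln K%:R))) / 2 * N%:R by lra.
by rewrite dE.
Qed.

(** At most log_p N exponents qualify, each with weight ln p, and none does unless p^2 <= N. *)
Lemma sum_ln_higher_powers (R : realType) (p N : nat) : prime p -> (0 < N)%N ->
  \sum_(2 <= k < N.+1 | (p ^ k <= N)%N) ln p%:R <= (if (p * p <= N)%N then ln N%:R else 0) :> R.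
Proof.
move=> pp N0; have p1 := prime_gt1 pp; have p0 := prime_gt0 pp.
case: leqP => pN; last first.
  rewrite big1_seq // => k /andP[pk]; rewrite mem_index_iota => /andP[k2 _].
  have : (p * p <= p ^ k)%N by rewrite mulnn leq_pexp2l.
  by move=> /leq_trans /(_ pk); rewrite leqNgt pN.
pose t := trunc_log p N.
have pt : (p ^ t <= N)%N by apply: trunc_logP.
have tN : (t <= N)%N by apply: leq_trans pt; apply: ltnW; apply: ltn_expl.
apply: (@le_trans _ _ (\sum_(1 <= k < t.+1) ln p%:R)).
  rewrite [leRHS](big_nat_widen _ _ N.+1) // (big_nat_widenl _ 1) //.
  rewrite big_mkcond [leRHS]big_mkcond; apply: ler_sum => k _ /=.
  case: (boolP (p ^ k <= N)%N) => pk /=; last by case: ifP => _; rewrite ?lnn_ge0.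
  rewrite (_ : (k < t.+1)%N); last by rewrite ltnS trunc_log_max.
  by case: ifP => _; rewrite ?lnn_ge0.
rewrite sumr_const_nat subn1 /= -lnXn ?ltr0n // -natrX ler_lnn //.
by rewrite expn_gt0 p0.
Qed.

Lemma sum_squares_le_sqrt (R : rcfType) (N : nat) :
  \sum_(1 <= p < N.+1) (p * p <= N)%:R <= Num.sqrt N%:R :> R.
Proof.
have H : forall m, (m * m <= N)%N ->
   \sum_(1 <= p < m.+1) (p * p <= N)%:R <= Num.sqrt N%:R :> R.
  move=> m mN; apply: (@le_trans _ _ (\sum_(1 <= p < m.+1) 1)).
    by apply: ler_sum => p _; rewrite lern1 leq_b1.
  rewrite sumr_const_nat subn1 /=; have m0 : 0 <= m%:R :> R by [].
  by rewrite -(ger0_norm m0) -sqrtr_sqr ler_sqrt // expr2 -natrM ler_nat.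
have [m mN] : exists2 m, (m * m <= N)%N & (N < m.+1 * m.+1)%N.
  elim: N {H} => [|N [m m1 m2]]; first by exists 0%N.
  have [|Nm] := leqP (m.+1 * m.+1) N.+1; last by exists m => //; apply: leqW.
  by move=> Hm; exists m.+1 => //; lia.
move=> Nm; have mN' : (m <= N)%N by apply: leq_trans mN; rewrite -{1}[m]muln1 leq_mul2l; case: (m).
rewrite (@big_cat_nat _ _ _ m.+1) //= [X in _ + X]big1_seq ?addr0; first exact: H.
move=> p /andP[_]; rewrite mem_index_iota => /andP[mp _].
by rewrite leqNgt (leq_trans Nm) // leq_mul.
Qed.

Lemma sum_chi4_prime_ln_littleo (R : realType) (eps : R) : 0 < eps ->
  exists N0 : nat, forall N, (N0 <= N)%N ->
  `|\sum_(1 <= p < N.+1 | prime p) chi4 R p * ln p%:R| <= eps * N%:R.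
Proof.
move=> eps0; have e20 : 0 < eps / 2 by rewrite divr_gt0.
have [H HH] := sum_tmoebius_chi4_ln_littleo e20.
have [m m0 mE] : exists2 m : nat, (0 < m)%N & 8 / eps <= m%:R.
  by exists (Num.truncn (8 / eps)).+1 => //; apply/ltW/truncnS_gt.
exists (H + (m ^ 2) ^ 2)%N => N HN.
have := HH N (leq_trans (leq_addr _ _) HN).
have mN := leq_trans (leq_addl _ _) HN.
have N0 : (0 < N)%N by apply: leq_trans mN; rewrite !expn_gt0 m0.
have NR : 0 < N%:R :> R by rewrite ltr0n.
rewrite sum_tmoebius_chi4_ln.
pose Q p : R := \sum_(2 <= k < N.+1 | (p ^ k <= N)%N) chi4 R (p ^ k) * ln p%:R.
have -> : \sum_(1 <= p < N.+1 | prime p) \sum_(1 <= k < N.+1 | (p ^ k <= N)%N)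
    chi4 R (p ^ k) * ln p%:R =
  \sum_(1 <= p < N.+1 | prime p) chi4 R p * ln p%:R + \sum_(1 <= p < N.+1 | prime p) Q p.
  rewrite -big_split /= big_nat_cond [RHS]big_nat_cond.
  apply: eq_bigr => p /andP[/andP[_ pN] _].
  by rewrite big_ltn_cond ?ltnS // expn1 -ltnS pN.
have QN : `|\sum_(1 <= p < N.+1 | prime p) Q p| <= eps / 2 * N%:R.
  apply: (le_trans (ler_norm_sum _ _ _)).
  apply: (@le_trans _ _ (\sum_(1 <= p < N.+1) ((p * p <= N)%:R * ln N%:R))).
    rewrite big_mkcond; apply: ler_sum => p _; case: ifP => pp; last by rewrite mulr_ge0 ?lnn_ge0.
    apply: (@le_trans _ _ (if (p * p <= N)%N then ln N%:R else 0)); last first.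
      by case: leqP; rewrite ?mul1r ?mul0r.
    apply: le_trans (sum_ln_higher_powers R pp N0).
    apply: (le_trans (ler_norm_sum _ _ _)); apply: ler_sum => k _.
    rewrite normrM [X in _ * X]ger0_norm ?lnn_ge0 // ler_piMl ?lnn_ge0 //.
    by rewrite normr_chi4 lern1 leq_b1.
  rewrite -mulr_suml; apply: (le_trans (ler_wpM2r (lnn_ge0 R N) (sum_squares_le_sqrt R N))).
  have r0 : 0 < Num.sqrt N%:R :> R by rewrite sqrtr_gt0.
  have rE : Num.sqrt N%:R ^+ 2 = N%:R :> R by rewrite sqr_sqrtr // ltW.
  have mr : m%:R <= Num.sqrt (Num.sqrt N%:R) :> R.
    have E x : 0 <= x -> x = Num.sqrt (x ^+ 2) :> R by move=> x0; rewrite sqrtr_sqr ger0_norm.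
    rewrite (E m%:R) // (E (m%:R ^+ 2)) ?exprn_ge0 // !ler_sqrt ?sqrtr_ge0 ?ler0n //.
    by rewrite -!natrX ler_nat.
  (* This bounds sqrt N ln N by 4 N^(3/4), and the threshold m^4 turns that into (eps / 2) N. *)
  have lN : ln N%:R <= 4 * Num.sqrt (Num.sqrt N%:R) :> R.
    rewrite -{1}rE lnXn // -[leLHS]mulr_natl; have := ln_le_2sqrt r0; lra.
  have s0 : 0 < Num.sqrt (Num.sqrt N%:R) :> R by rewrite sqrtr_gt0.
  have sE : Num.sqrt (Num.sqrt N%:R) ^+ 2 = Num.sqrt N%:R :> R by rewrite sqr_sqrtr // ltW.
  move: r0 rE mr lN s0 sE; move: (Num.sqrt (Num.sqrt N%:R) : R) => s; move: (Num.sqrt N%:R : R) => r.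
  move=> r0 rE mr lN s0 sE.
  apply: (le_trans (ler_wpM2l (ltW r0) lN)); rewrite -rE.
  have es : 8 <= eps * s.
    move: mE; rewrite ler_pdivrMr // => /le_trans; apply.
    by rewrite [leRHS]mulrC ler_pM2r.
  have H4 : 4 * s <= eps / 2 * r by rewrite -sE; have := ler_wpM2l (ltW s0) es; lra.
  by have := ler_wpM2l (ltW r0) H4; lra.
set S1 := \sum_(_ <= _ < _ | _) _ * _; set S2 := \sum_(_ <= _ < _ | _) Q _ in QN *.
move=> H12; have -> : S1 = (S1 + S2) - S2 by ring.
by apply: (le_trans (ler_normB _ _)); lra.
Qed.

(** Lets ln p be replaced by ln N at cost o(N), using Chebyshev bounds alone. Up to N / K the primes
    are bounded by all integers. Beyond, ln (N / p) <= ln K, a small multiple ln K / ln b of ln p,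
    and [theta_le] applies; hence 18 = 2 * 9. *)
Lemma sum_prime_ln_ratio_littleo (R : realType) (eps : R) : 0 < eps ->
  exists N0 : nat, forall N, (N0 <= N)%N ->
  \sum_(1 <= p < N.+1 | prime p) (ln N%:R - ln p%:R) <= eps * N%:R.
Proof.
move=> eps0.
have [m m0 mE] : exists2 m : nat, (0 < m)%N & 8 / eps <= m%:R.
  by exists (Num.truncn (8 / eps)).+1 => //; apply/ltW/truncnS_gt.
pose K := (m * m)%N.
have K0 : (0 < K)%N by rewrite muln_gt0 m0.
have lK : 0 <= ln K%:R :> R by apply: lnn_ge0.
have [b b1 bE] : exists2 b : nat, (1 < b)%N & 18 * ln K%:R / eps <= ln b%:R.
  exists (Num.truncn (expR (18 * ln K%:R / eps))).+2 => //.
  rewrite -[leLHS]expRK ler_ln ?posrE ?expR_gt0 ?ltr0n //.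
  by apply/ltW/(lt_le_trans (truncnS_gt _)); rewrite ler_nat.
exists (b * K)%N => N HN.
pose B := (N %/ K)%N.
have bB : (b <= B)%N by rewrite leq_divRL.
have BN : (B <= N)%N by apply: leq_div.
have N0 : (0 < N)%N by apply: leq_trans BN; apply: leq_trans bB; apply: ltnW.
have NR : 0 < N%:R :> R by rewrite ltr0n.
rewrite (@big_cat_nat _ _ _ B.+1) //=.
have -> : eps * N%:R = eps / 2 * N%:R + eps / 2 * N%:R by lra.
apply: lerD.
  apply: (@le_trans _ _ (\sum_(1 <= a < B.+1) ln (N%:R / a%:R))).
    rewrite big_mkcond big_nat [leRHS]big_nat; apply: ler_sum => a /andP[a0 aB].
    rewrite ln_div ?posrE ?ltr0n //; case: ifP => // _.
    by rewrite subr_ge0 ler_lnn // (leq_trans _ BN).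
  apply: (le_trans (sum_ln_ratio_le R BN)).
  apply: (@le_trans _ _ (4 * (N%:R / m%:R))).
    by rewrite ler_pM2l // sqrt_divn_sqr_le.
  have : m%:R^-1 <= eps / 8 by rewrite -[leRHS]invrK lef_pV2 ?posrE ?invr_gt0 ?divr_gt0 ?ltr0n // invf_div.
  by move=> /(ler_wpM2l (ltW NR)); lra.
have lb : 0 < ln b%:R :> R by rewrite ln_gt0 // ltr1n.
apply: (@le_trans _ _ (\sum_(B.+1 <= p < N.+1 | prime p) ln K%:R / ln b%:R * ln p%:R)).
  rewrite big_nat_cond [leRHS]big_nat_cond; apply: ler_sum => p /andP[/andP[Bp pN] pp].
  have p0 := prime_gt0 pp.
  apply: (@le_trans _ _ (ln K%:R)).
    rewrite lerBlDr -lnM ?posrE ?ltr0n // -natrM ler_lnn //.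
    apply: ltnW; apply: (leq_trans (ltn_ceil N K0)).
    by rewrite mulnC leq_mul2l Bp orbT.
  rewrite mulrAC -mulrA ler_peMr // ler_pdivlMr // mul1r ler_lnn //; first exact: ltnW.
  by apply: leq_trans bB _; apply: ltnW.
rewrite -mulr_sumr.
have th : \sum_(B.+1 <= p < N.+1 | prime p) ln p%:R <= 9 * N%:R :> R.
  apply: le_trans (theta_le R N); rewrite [leRHS](@big_cat_nat _ _ _ B.+1) //= lerDr.
  by apply: sumr_ge0 => *; apply: lnn_ge0.
have Kb : 0 <= ln K%:R / ln b%:R :> R by rewrite divr_ge0 // ltW.
apply: (le_trans (ler_wpM2l Kb th)).
rewrite mulrA ler_pM2r // mulrAC ler_pdivrMr //.
by move: bE; rewrite ler_pdivrMr // => ?; lra.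
Qed.

(** Removes the weight ln p by comparison with ln N; Chebyshev's lower bound turns o(N) into o(pi(N)
    ln N). *)
Lemma sum_chi4_prime_littleo (R : realType) (eps : R) : 0 < eps ->
  exists N0 : nat, forall N, (N0 <= N)%N ->
  `|\sum_(1 <= p < N.+1 | prime p) chi4 R p| <= eps * \sum_(1 <= p < N.+1 | prime p) 1.
Proof.
move=> eps0; have [C C0 HC] := prime_count_ge R.
have CR : 0 < C%:R :> R by rewrite ltr0n.
pose d := eps / (2 * C%:R); have d0 : 0 < d by rewrite divr_gt0 // mulr_gt0.
have dE : d * (2 * C%:R) = eps by rewrite divfK // gt_eqF // mulr_gt0.
have [H1 HH1] := sum_chi4_prime_ln_littleo d0.
have [H2 HH2] := sum_prime_ln_ratio_littleo d0.
exists (H1 + H2 + C).+1 => N HN.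
have [NH1 NH2 NC] : [/\ H1 <= N, H2 <= N & C <= N]%N by split; lia.
have N1 : (1 < N)%N by lia.
have lN : 0 < ln N%:R :> R by rewrite ln_gt0 // ltr1n.
have := HC N NC; have := HH1 N NH1; have := HH2 N NH2.
set P := \sum_(_ <= _ < _ | _) 1; set L := \sum_(_ <= _ < _ | _) (_ - _).
set S := \sum_(_ <= _ < _ | _) _ * _; set X := \sum_(_ <= _ < _ | _) chi4 _ _.
move=> A1 A2 A3; rewrite -(ler_pM2r lN) -[X in _ * X <= _](gtr0_norm lN) -normrM.
have A4 : `|X * ln N%:R - S| <= L.
  rewrite mulr_suml -sumrB; apply: (le_trans (ler_norm_sum _ _ _)).
  rewrite big_nat_cond [leRHS]big_nat_cond; apply: ler_sum => p /andP[/andP[_ pN] pp].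
  have pl : 0 <= ln N%:R - ln p%:R :> R by rewrite subr_ge0 ler_lnn ?prime_gt0.
  rewrite -mulrBr normrM (ger0_norm pl) ler_piMl //.
  by rewrite normr_chi4 lern1 leq_b1.
have -> : X * ln N%:R = (X * ln N%:R - S) + S by ring.
apply: (le_trans (ler_normD _ _)).
have := ler_wpM2l (ltW d0) A3.
by rewrite -dE; lra.
Qed.

(** * Totients *)

Lemma totient_split (p n : nat) : prime p -> (0 < n)%N -> (p %| n)%N ->
  exists k m : nat, [/\ coprime p m, (0 < m)%N, n = (m * p ^ k.+1)%N &
    totient n = (totient m * (p.-1 * p ^ k))%N].
Proof.
move=> pp n0 pn; have [m cpm nE] := pfactor_coprime pp n0.
have l0 : (0 < logn p n)%N by rewrite logn_gt0 mem_primes pp n0.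
have m0 : (0 < m)%N by move: n0; rewrite nE muln_gt0 => /andP[].
exists (logn p n).-1, m; rewrite prednK //; split=> //.
rewrite {1}nE totient_coprime; last by rewrite coprimeXr // coprime_sym.
by rewrite totient_pfactor.
Qed.

Lemma odd_predn_prime (p : nat) : prime p -> odd p -> ~~ odd p.-1.
Proof. by move=> /prime_gt0; case: p => //= p _; rewrite negbK. Qed.

Lemma odd_totient (n : nat) : (0 < n)%N -> odd (totient n) -> (n <= 2)%N.
Proof.
elim/ltn_ind: n => n IH n0 on; have [//|n1] := leqP n 1; first exact: leqW.
have pp := pdiv_prime n1; have pn := pdiv_dvd n.
have [k [m [cpm m0 nE tE]]] := totient_split pp n0 pn.
move: on; rewrite tE !oddM => /and3P[om op okk].
have [p2|/(odd_predn_prime pp)] := even_prime pp; last by rewrite op.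
rewrite p2 in nE okk cpm.
have k0 : k = 0%N by move: okk; rewrite oddX orbF => /eqP.
rewrite k0 expn1 in nE.
have m2 : (m <= 2)%N by apply: IH => //; lia.
have : odd m by rewrite -coprime2n.
by rewrite nE; move: m m2 {cpm m0 nE tE om} => [|[|[|m]]].
Qed.

(** Each odd prime factor makes an even contribution to phi(n), and 2 r has a single factor 2. So n
    has at most one odd prime factor p; its cofactor has odd totient, hence is 1 or 2, and p - 1 is
    2 mod 4. *)
Lemma totient_twice_odd (n r : nat) : (0 < n)%N -> odd r -> totient n = (2 * r)%N ->
  n = 4%N \/ exists p k : nat, [/\ prime p, (p %% 4 = 3)%N,
    n = (p ^ k.+1)%N \/ n = (2 * p ^ k.+1)%N & (2 * r = p.-1 * p ^ k)%N].
Proof.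
move=> n0 orr nr.
have [/hasP[p]|] := boolP (has odd (primes n)).
  rewrite mem_primes => /and3P[pp _ pn] op; right.
  have [k [m [cpm m0 nE tE]]] := totient_split pp n0 pn.
  have pE : p.-1 = p.-1./2.*2.
    by rewrite -{1}[p.-1]odd_double_half (negbTE (odd_predn_prime pp op)).
  have rE : r = (totient m * (p.-1./2 * p ^ k))%N.
    by apply/eqP; rewrite -(eqn_pmul2l (isT : 0 < 2)%N) -nr tE {1}pE -muln2; apply/eqP; ring.
  move: (orr); rewrite {1}rE !oddM => /and3P[om op2 _].
  have m2 := odd_totient m0 om.
  exists p, k; split=> //.
  - have p0 := prime_gt0 pp; have := odd_double_half p.-1./2; rewrite op2 => H.
    have -> : p = (4 * p.-1./2./2 + 3)%N.
      by move: pE H p0; clear; lia.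
    by rewrite mulnC modnMDl.
  - by rewrite nE; move: m m0 m2 {cpm nE tE om rE} => [|[|[|m]]] // _ _; rewrite ?mul1n; [left|right].
  - have tm : totient m = 1%N by move: m m0 m2 {cpm nE tE om rE} => [|[|[|m]]].
    by rewrite -nr tE tm mul1n.
move=> /hasPn no; left.
have [n1|n1] := leqP n 1.
  have n1' : n = 1%N by apply/eqP; rewrite eqn_leq n1.
  by move: nr; rewrite n1' => /(congr1 odd); rewrite oddM.
have p2 m : (m %| n)%N -> (1 < m)%N -> pdiv m = 2%N.
  move=> mn m1; have pp := pdiv_prime m1.
  have [//|op] := even_prime pp.
  by have := no (pdiv m); rewrite mem_primes pp n0 (dvdn_trans (pdiv_dvd m) mn) op => /(_ isT).
have n2 : (2 %| n)%N by rewrite -(p2 n) ?pdiv_dvd.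
have [k [m [cpm m0 nE tE]]] := totient_split (isT : prime 2) n0 n2.
have m1 : m = 1%N.
  have [m1|m1] := leqP m 1; first by apply/eqP; rewrite eqn_leq m1.
  have mn : (m %| n)%N by rewrite nE dvdn_mulr.
  by move: cpm; rewrite prime_coprime // -(p2 m mn m1) pdiv_dvd.
move: nr; rewrite tE m1 (erefl : totient 1 = 1%N) !mul1n => nr.
case: k nE {tE} nr => [|[|k]]; rewrite m1 mul1n => nE nr //; first by lia.
by move: nr; rewrite expnS => /eqP; rewrite eqn_pmul2l // => /eqP rE; move: orr; rewrite -rE expnS oddM.
Qed.

(** For q = 3 the value 2 would have the third preimage 4. The last hypothesis rules out the
    preimages p^k and 2 p^k with k >= 2. *)
Lemma totient_fiber_prime (q : nat) : prime q -> (q %% 4 = 3)%N -> (q != 3)%N ->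
  (forall p k, prime p -> q.-1 <> (p.-1 * p ^ k.+1)%N) ->
  forall n, (0 < n)%N /\ totient n = q.-1 <-> n = q \/ n = (2 * q)%N.
Proof.
move=> pq q4 q3 noW n; have q0 := prime_gt0 pq.
have qE : (q = 2 * (2 * (q %/ 4) + 1) + 1)%N by rewrite {1}(divn_eq q 4) q4; ring.
have rE : (q.-1 = 2 * (2 * (q %/ 4) + 1))%N by rewrite {1}qE addn1.
have orr : odd (2 * (q %/ 4) + 1) by rewrite oddD oddM.
split=> [[n0 nq]|].
  rewrite rE in nq; have [n4|[p [k [pp _ nE kE]]]] := totient_twice_odd n0 orr nq.
    by move: nq; rewrite n4 => nq; move: q3; rewrite qE -nq.
  case: k nE kE => [|k] nE kE; last by have := noW p k pp; rewrite rE kE.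
  have pE : p = q.
    by rewrite expn0 muln1 -rE in kE; rewrite -(prednK q0) kE prednK // prime_gt0.
  by move: nE; rewrite expn1 pE.
have oq : odd q by rewrite qE oddD oddM.
case=> ->; first by rewrite totient_prime.
split; first by rewrite muln_gt0.
by rewrite totient_coprime ?coprime2n // [totient q]totient_prime // mul1n.
Qed.

(** * Counting *)

Lemma ln_sqr_littleo (R : realType) (eps : R) : 0 < eps ->
  exists N0 : nat, forall N, (N0 <= N)%N -> ln N%:R ^+ 2 <= eps * Num.sqrt N%:R.
Proof.
move=> eps0; have [m m0 mE] : exists2 m : nat, (0 < m)%N & 64 / eps <= m%:R.
  by exists (Num.truncn (64 / eps)).+1 => //; apply/ltW/truncnS_gt.
exists ((m ^ 2) ^ 2)%N => N mN.
have N0 : (0 < N)%N by apply: leq_trans mN; rewrite !expn_gt0 m0.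
have NR : 0 < N%:R :> R by rewrite ltr0n.
pose r : R := Num.sqrt N%:R; pose s := Num.sqrt r; pose t := Num.sqrt s.
have r0 : 0 < r by rewrite sqrtr_gt0.
have s0 : 0 < s by rewrite sqrtr_gt0.
have t0 : 0 < t by rewrite sqrtr_gt0.
have rE : r ^+ 2 = N%:R by rewrite sqr_sqrtr // ltW.
have sE : s ^+ 2 = r by rewrite sqr_sqrtr // ltW.
have tE : t ^+ 2 = s by rewrite sqr_sqrtr // ltW.
have ms : m%:R <= s.
  have E x : 0 <= x -> x = Num.sqrt (x ^+ 2) :> R by move=> x0; rewrite sqrtr_sqr ger0_norm.
  rewrite (E m%:R) // (E (m%:R ^+ 2)) ?exprn_ge0 // !ler_sqrt ?sqrtr_ge0 ?ler0n //.
  by rewrite -!natrX ler_nat.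
(* As t = N^(1/8), the square of ln N is at most 64 N^(1/4), and the threshold m^4 gives N^(1/4) >=
   64 / eps. *)
have lt : ln N%:R <= 8 * t.
  rewrite -rE lnXn // -sE lnXn // -!mulrnA -[leLHS]mulr_natl.
  have := ln_le_2sqrt s0; rewrite -/t => H; lra.
have es : 64 <= eps * s.
  by move: mE; rewrite ler_pdivrMr // => /le_trans; apply; rewrite [leRHS]mulrC ler_pM2r.
apply: (@le_trans _ _ ((8 * t) ^+ 2)).
  by rewrite ler_sqr ?nnegrE ?lnn_ge0 // mulr_ge0 // ltW.
rewrite -/r -sE exprMn tE; have := ler_wpM2r (ltW s0) es; lra.
Qed.

(* m = phi(p^(k+2)) for some k >= 0. *)
Definition prime_power_totient (m : nat) : Prop :=
  exists p k : nat, prime p /\ m = (p.-1 * p ^ k.+1)%N.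

(** Each m counted comes from a p^j with j >= 2 and p^j <= 2 m <= 2 N, since p <= 2 (p - 1).
    Multiplying by ln 2 <= ln p turns the count into a sum of ln p over prime powers, which
    [sum_ln_higher_powers] bounds by ln (2 N) for each p <= sqrt (2 N). *)
Lemma count_prime_power_totient (R : realType) (N : nat) :
  \sum_(0 <= m < N.+1) `[< prime_power_totient m >]%:R
  <= Num.sqrt (2 * N)%:R * ln (2 * N)%:R / ln 2 :> R.
Proof.
have l2 : 0 < ln 2 :> R by rewrite ln_gt0 // ltr1n.
pose y := (2 * N)%N.
rewrite -/y ler_pdivlMr // mulr_suml.
pose F m p j : R := (m == p.-1 * p ^ j.-1)%N%:R * ln p%:R.
have F0 m p j : 0 <= F m p j by rewrite mulr_ge0 ?lnn_ge0.
apply: (@le_trans _ _ (\sum_(0 <= m < N.+1) \sum_(1 <= p < y.+1 | prime p)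
    \sum_(2 <= j < y.+1 | (p ^ j <= y)%N) F m p j)).
  rewrite big_nat [leRHS]big_nat; apply: ler_sum => m /andP[_ mN].
  case: asboolP => [[p [k [pp mE]]]|_]; last first.
    by rewrite mul0r; apply: sumr_ge0 => p _; apply: sumr_ge0.
  have p1 := prime_gt1 pp; have p0 := prime_gt0 pp.
  have pj : (p ^ k.+2 <= y)%N.
    apply: (@leq_trans (2 * m)%N); last by rewrite leq_mul2l -ltnS mN.
    by rewrite mE mulnA expnS leq_mul2r; apply/orP; right; move: p1; clear; lia.
  have py : (p <= y)%N.
    by apply: leq_trans pj; rewrite -{1}[p]expn1 leq_pexp2l.
  have jy : (k.+2 <= y)%N.
    by apply: leq_trans pj; apply: ltnW; apply: ltn_expl.
  rewrite (big_rem p) ?mem_index_iota ?p0 //= pp -[leLHS]addr0; apply: lerD; last first.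
    by apply: sumr_ge0 => q _; apply: sumr_ge0.
  rewrite (big_rem k.+2) ?mem_index_iota //= pj -[leLHS]addr0; apply: lerD; last first.
    exact: sumr_ge0.
  by rewrite /F mE eqxx ler_pM2l // ler_lnn.
rewrite exchange_big /=.
apply: (@le_trans _ _ (\sum_(1 <= p < y.+1) (p * p <= y)%:R * ln y%:R)); last first.
  by rewrite -mulr_suml ler_wpM2r ?lnn_ge0 // sum_squares_le_sqrt.
rewrite big_mkcond big_nat [leRHS]big_nat; apply: ler_sum => p /andP[p0 py].
case: ifP => pp; last by rewrite mulr_ge0 ?lnn_ge0.
have y0 : (0 < y)%N by apply: leq_trans p0 _; rewrite -ltnS.
apply: (@le_trans _ _ (if (p * p <= y)%N then ln y%:R else 0)); last first.
  by case: leqP; rewrite ?mul1r ?mul0r.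
apply: le_trans (sum_ln_higher_powers R pp y0).
rewrite exchange_big /=; apply: ler_sum => j _.
rewrite -mulr_suml ler_piMl ?lnn_ge0 //.
apply: (@le_trans _ _ (\sum_(0 <= m < N.+1 | m == (p.-1 * p ^ j.-1)%N) 1)).
  by rewrite [leRHS]big_mkcond; apply: ler_sum => m _; case: eqP.
by rewrite big_nat1_eq; case: ifP.
Qed.

Lemma totient_fiber_neq0 (m : nat) : totient_mult m = 2%N ->
  exists2 n, (0 < n)%N & totient n = m.
Proof.
rewrite /totient_mult; have [->|/set0P[n [n0 nm]] _] := eqVneq (totient_fiber m) set0.
  by rewrite fset_set0 cardfs0.
by exists n.
Qed.

Definition prime_3mod4 (p : nat) : bool := prime p && (p %% 4 == 3)%N.

Lemma twice_odd_mult2_sub (m : nat) : twice_odd_mult2 m ->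
  prime_3mod4 m.+1 \/ prime_power_totient m.
Proof.
move=> [r orr [mE /totient_fiber_neq0[n n0 nm]]].
rewrite mE in nm; have [n4|[p [k [pp p4 _ kE]]]] := totient_twice_odd n0 orr nm.
  (* The preimage 4 gives m = 2, and 3 is again a prime congruent to 3 mod 4. *)
  by left; rewrite mE -nm n4.
case: k kE => [|k] kE; last by right; exists p, k; rewrite mE.
by left; rewrite mE kE muln1 prednK ?prime_gt0 // /prime_3mod4 pp p4.
Qed.

Lemma twice_odd_mult2_sup (m : nat) : prime_3mod4 m.+1 -> m != 2%N ->
  ~ prime_power_totient m -> twice_odd_mult2 m.
Proof.
move=> /andP[pm /eqP m4] m2 nW.
have m3 : m.+1 != 3%N by [].
have fib := totient_fiber_prime pm m4 m3 (fun p k pp E => nW (ex_intro _ p (ex_intro _ k (conj pp E)))).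
have mE : m = (2 * (2 * (m.+1 %/ 4) + 1))%N.
  by apply: succn_inj; rewrite {1}(divn_eq m.+1 4) m4; ring.
exists (2 * (m.+1 %/ 4) + 1)%N; first by rewrite oddD oddM.
split=> //; rewrite /totient_mult.
have -> : fset_set (totient_fiber m) = [fset m.+1; (2 * m.+1)%N]%fset.
  apply/fsetP => n; rewrite in_fset_set; last exact: finite_totient_fiber.
  rewrite !inE; apply/idP/idP => [|nE].
    by rewrite inE => /fib[->|->]; rewrite eqxx ?orbT.
  by rewrite inE; apply/fib; case/orP: nE => /eqP; [left|right].
by rewrite cardfs2 -{1}[m.+1]mul1n eqn_pmul2r.
Qed.

Lemma counting_funE (R : realType) (S : set nat) (x : R) : 0 <= x ->
  (counting_fun S x)%:R = \sum_(0 <= m < (Num.truncn x).+1) `[< S m >]%:R :> R.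
Proof.
move=> x0; rewrite -natr_sum; congr (_%:R); rewrite /counting_fun.
have -> : fset_set (upto S x) = [fset m in [seq m <- index_iota 0 (Num.truncn x).+1 | `[< S m >]]]%fset.
  apply/fsetP => m; rewrite in_fset_set; last exact: finite_upto.
  rewrite !inE mem_filter mem_index_iota /= ltnS truncn_ge_nat //.
  by apply/idP/andP => [|[/asboolP Sm mx]]; rewrite inE; [case=> Sm mx; split=> //; apply/asboolP | split].
rewrite card_fseq undup_id ?filter_uniq ?iota_uniq // size_filter -sum1_count big_mkcond.
by apply: eq_bigr => m _; case: asboolP.
Qed.

Lemma chi4_odd (R : pzRingType) (n : nat) : odd n ->
  chi4 R n = if (n %% 4 == 3)%N then -1 else 1.
Proof.
move=> on; rewrite /chi4 on -signr_odd.
have -> : odd n./2 = (n %% 4 == 3)%N by move: on; lia.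
by case: eqP.
Qed.

(** For odd p the indicator of 3 mod 4 is (1 - chi(p)) / 2. At p = 2 this formula gives 1/2 instead
    of 0, whence the added 1 on the right. *)
Lemma sum_primes_3mod4 (R : realType) (N : nat) :
  `|\sum_(1 <= p < N.+1) (prime_3mod4 p)%:R - (\sum_(1 <= p < N.+1 | prime p) 1) / 2 : R|
  <= (`|\sum_(1 <= p < N.+1 | prime p) chi4 R p| + 1) / 2.
Proof.
set X := \sum_(_ <= _ < _ | _) chi4 _ _; set P := \sum_(_ <= _ < _ | _) 1.
set T : R := \sum_(_ <= _ < _) _.
pose c : R := if (2 <= N)%N then 1 else 0.
have TE : 2 * T = P - X - c.
  rewrite /c.
  have -> : (if (2 <= N)%N then 1 else 0) = \sum_(1 <= p < N.+1) (if p == 2%N then 1 else 0) :> R.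
    by rewrite -big_mkcond big_nat1_eq.
  have -> : P = \sum_(1 <= p < N.+1) (if prime p then 1 else 0) by rewrite -big_mkcond.
  have -> : X = \sum_(1 <= p < N.+1) (if prime p then chi4 R p else 0) by rewrite -big_mkcond.
  rewrite /T -!sumrB mulr_sumr; apply: eq_bigr => p _.
  rewrite /prime_3mod4; have [pp|np] := boolP (prime p); last first.
    by rewrite ifF ?subr0 ?mulr0 //; apply: contraNF np => /eqP ->.
  have [->|op] := even_prime pp; first by rewrite /chi4 /= subr0 subrr mulr0.
  rewrite chi4_odd //= [p == 2%N]gtn_eqF ?subr0; last by apply: odd_prime_gt2.
  by case: eqP => _; rewrite ?mulr1 ?mulr0 ?opprK // subrr.
have [c0 c1] : 0 <= c /\ c <= 1 by rewrite /c; case: ifP; rewrite ?lexx ?ler01.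
have -> : T - P / 2 = (- X - c) / 2 by lra.
rewrite normrM [X in _ * X <= _]ger0_norm // ler_pM2r //.
by apply: (le_trans (ler_normB _ _)); rewrite normrN lerD2l ger0_norm.
Qed.

(** By Chebyshev it suffices that sqrt (2 N) ln (2 N) ln N = o(N), which follows from
    [ln_sqr_littleo]. The 3 makes room for the bounded errors of the final count: the value m = 2,
    the prime 2, and the shift from m to m + 1. *)
Lemma count_prime_power_totient_littleo (R : realType) (eps : R) : 0 < eps ->
  exists N0 : nat, forall N, (N0 <= N)%N ->
  \sum_(0 <= m < N.+1) `[< prime_power_totient m >]%:R + 3 <=
    eps * \sum_(1 <= p < N.+1 | prime p) 1 :> R.
Proof.
move=> eps0; have [C C0 HC] := prime_count_ge R.
have CR : 0 < C%:R :> R by rewrite ltr0n.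
have l2 : 0 < ln 2 :> R by rewrite ln_gt0 // ltr1n.
pose d : R := eps * ln 2 / (8 * C%:R).
have d0 : 0 < d by rewrite divr_gt0 ?mulr_gt0.
have dE : d * (8 * C%:R) = eps * ln 2 by rewrite divfK // gt_eqF // mulr_gt0.
have [H HH] := ln_sqr_littleo d0.
exists (H + C).+2 => N HN.
have [NH NC N1] : [/\ H <= 2 * N, C <= N & 1 < N]%N by split; move: HN; clear; lia.
have N0 : (0 < N)%N by apply: ltnW.
pose y : R := (2 * N)%:R.
have lN : 0 < ln N%:R :> R by rewrite ln_gt0 // ltr1n.
have lNy : ln N%:R <= ln y by rewrite ler_lnn // leq_pmull.
have ly2 : ln 2 <= ln y by rewrite (ler_lnn R (m := 2)) // leq_pmulr.
have y1 : 1 <= Num.sqrt y.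
  rewrite -[leLHS](sqrtr1 R) ler_sqrt ?ler0n // (ler_nat R 1) muln_gt0 N0 //.
have yE : Num.sqrt y ^+ 2 = 2 * N%:R by rewrite sqr_sqrtr ?ler0n // /y natrM.
have := HH _ NH; rewrite -/y; have := HC N NC.
set P := \sum_(_ <= _ < _ | _) 1 => HP Hy.
have := count_prime_power_totient R N; rewrite -/y.
set W := \sum_(_ <= _ < _) `[< _ >]%:R => HW.
have s0 : 0 < Num.sqrt y by lra.
have H1 : W * ln 2 <= Num.sqrt y * ln y by rewrite -ler_pdivlMr.
have H2 : 3 * ln 2 <= 3 * (Num.sqrt y * ln y).
  by rewrite ler_pM2l //; apply: (le_trans ly2); rewrite ler_peMl //; lra.
have H3 : (W + 3) * ln 2 <= 4 * (Num.sqrt y * ln y) by lra.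
have H4 : (W + 3) * ln 2 * ln N%:R <= 4 * (Num.sqrt y * ln y) * ln y.
  apply: (le_trans (ler_wpM2r (ltW lN) H3)); rewrite ler_wpM2l // !mulr_ge0 //; lra.
have H5 := ler_wpM2l (ltW s0) Hy.
have H6 : (W + 3) * ln 2 * ln N%:R <= 8 * d * N%:R.
  have E5 : Num.sqrt y * (d * Num.sqrt y) = d * (2 * N%:R) by rewrite -yE; ring.
  by rewrite E5 in H5; lra.
have H7 : 8 * d * N%:R <= eps * P * ln 2 * ln N%:R.
  have -> : eps * P * ln 2 * ln N%:R = d * 8 * (C%:R * P * ln N%:R).
    have -> : eps * P * ln 2 * ln N%:R = (eps * ln 2) * P * ln N%:R by ring.
    by rewrite -dE; ring.
  have d8 : 0 <= d * 8 by lra.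
  by have := ler_wpM2l d8 HP; lra.
by rewrite -(ler_pM2r l2) -(ler_pM2r lN); apply: (le_trans H6).
Qed.

(** The two conditions can disagree only at totients of higher prime powers and at m = 2, where 3 is
    a prime congruent to 3 mod 4 but 2 has the three preimages 3, 4 and 6. *)
Lemma count_twice_odd_mult2 (R : realType) (N : nat) :
  `|\sum_(0 <= m < N.+1) `[< twice_odd_mult2 m >]%:R
    - \sum_(0 <= m < N.+1) (prime_3mod4 m.+1)%:R : R|
  <= \sum_(0 <= m < N.+1) `[< prime_power_totient m >]%:R + 1.
Proof.
rewrite -sumrB; apply: (le_trans (ler_norm_sum _ _ _)).
apply: (@le_trans _ _ (\sum_(0 <= m < N.+1)
    (`[< prime_power_totient m >]%:R + (if m == 2%N then 1 else 0)))); last first.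
  by rewrite big_split /= lerD2l -big_mkcond big_nat1_eq; case: ifP.
apply: ler_sum => m _.
case: asboolP => [/twice_odd_mult2_sub vm|nv]; case: (asboolP (prime_power_totient m)) => wm.
- by case: prime_3mod4; case: ifP => _; rewrite ?subrr ?subr0 ?normr0 ?normr1 ?addr_ge0 ?lerDl.
- by case: vm => [->|//]; rewrite subrr normr0 add0r; case: ifP.
- by case: prime_3mod4; case: ifP => _; rewrite ?sub0r ?subrr ?normrN ?normr0 ?normr1 ?addr_ge0 ?lerDl.
- have [tm|_] := boolP (prime_3mod4 m.+1); last by rewrite subrr normr0 add0r; case: ifP.
  have [m2|m2] := eqVneq m 2%N; first by rewrite sub0r normrN normr1 add0r.
  by case: nv; apply: twice_odd_mult2_sup.
Qed.

Theorem theorem2p4 (R : realType) :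
  (fun x : R => (counting_fun twice_odd_mult2 x)%:R : R^o) ~_(pinfty_nbhs R)
  (fun x : R => (prime_pi x)%:R / 2 : R^o).
Proof.
apply/eqaddoP => eps eps0.
have e80 : 0 < eps / 8 by rewrite divr_gt0.
have [H1 HH1] := count_prime_power_totient_littleo e80.
have [H2 HH2] := sum_chi4_prime_littleo e80.
exists (H1 + H2)%:R; split=> // x Hx.
have x0 : 0 <= x by apply: le_trans (ltW Hx).
rewrite /= !fctE /prime_pi !counting_funE //.
have HN : (H1 + H2 <= Num.truncn x)%N by rewrite truncn_ge_nat // ltW.
move: (Num.truncn x) HN => N HN.
have := HH1 N (leq_trans (leq_addr _ _) HN).
have := HH2 N (leq_trans (leq_addl _ _) HN).
have := sum_primes_3mod4 R N; have := count_twice_odd_mult2 R N.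
have -> : \sum_(0 <= m < N.+1) `[< [set p | prime p] m >]%:R =
    \sum_(1 <= p < N.+1 | prime p) 1 :> R.
  have p0 : `[< [set p | prime p] 0%N >] = false by apply/negbTE/asboolPn.
  rewrite big_ltn // p0 add0r.
  by rewrite [RHS]big_mkcond; apply: eq_bigr => p _; rewrite asboolb; case: prime.
(* The values are m = p - 1, so m <= N admits one more candidate prime, N + 1. *)
have -> : \sum_(0 <= m < N.+1) (prime_3mod4 m.+1)%:R =
    \sum_(1 <= p < N.+1) (prime_3mod4 p)%:R + (prime_3mod4 N.+1)%:R :> R.
  transitivity (\sum_(1 <= p < N.+2) (prime_3mod4 p)%:R : R); first by rewrite big_add1.
  by rewrite big_nat_recr.
have : (prime_3mod4 N.+1)%:R <= 1 :> R by rewrite lern1 leq_b1.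
have : 0 <= (prime_3mod4 N.+1)%:R :> R by [].
set X := \sum_(_ <= _ < _ | _) chi4 _ _; set P := \sum_(_ <= _ < _ | _) 1.
have P0 : 0 <= P by apply: sumr_ge0.
set V := \sum_(_ <= _ < _) `[< twice_odd_mult2 _ >]%:R.
set T := \sum_(_ <= _ < _) (prime_3mod4 _)%:R.
set W := \sum_(_ <= _ < _) `[< prime_power_totient _ >]%:R.
move: ((prime_3mod4 N.+1)%:R : R) => t t0 t1 A1 A2 A3 A4.
rewrite [X in _ <= _ * X]ger0_norm ?divr_ge0 //.
move: A1 A2; rewrite !ler_norml => /andP[? ?] /andP[? ?].
by apply/andP; split; lra.
Qed.
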